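(* Let $\mathcal{C}$ be an abelian category and let $\mathcal{Z},\nu\subseteq\mathcal{C}$ be classes of objects such that $\mathcal{Z}=\mathrm{smd}(\mathcal{Z})$ is closed under extensions, $\mathrm{add}(\nu)=\nu$ and $\nu$ is $\mathcal{Z}$-injective. Then the following statements hold true. (a) The classes $(\mathcal{Z},\nu)_{\infty}^{\vee}$ and $(\mathcal{Z},\nu)^{\vee}$ are closed under extensions and direct summands. Moreover, we have the equalities (a1) $(\mathcal{Z},\nu)_{\infty}^{\vee}=(\mathcal{Z},\mathcal{Z}\cap\nu)_{\infty}^{\vee}$; (a2) $(\mathcal{Z},\nu)^{\vee}=(\mathcal{Z},\mathcal{Z}\cap\nu)^{\vee}=\{M\in(\mathcal{Z},\nu)_{\infty}^{\vee} : \mathrm{id}_{(\mathcal{Z},\nu)_{\infty}^{\vee}}(M)<\infty\}$. (b) $\mathrm{id}_{(\mathcal{Z},\nu)_{\infty}^{\vee}}(M)=\mathrm{coresdim}_{\nu}^{\mathcal{Z}}(M)$ for all $M\in(\mathcal{Z},\nu)^{\vee}$. (c) The classes $(\mathcal{Z},\nu)_{\infty}^{\vee}$ and $(\mathcal{Z},\nu)^{\vee}$ are left thick if $\mathcal{Z}$ is left thick.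
   Context: $\mathrm{smd}(\mathcal{M})$ is the class of all direct summands of objects in $\mathcal{M}$; $\mathrm{add}(\mathcal{M})$ is the class of all direct summands of finite coproducts of objects in $\mathcal{M}$. With $\mathrm{Ext}$ the Yoneda Ext, for a class $\mathcal{A}$ and an object $C$, $\mathrm{id}_{\mathcal{A}}(C):=\min\{n\in\mathbb{N} : \mathrm{Ext}^k_{\mathcal{C}}(A,C)=0\ \forall A\in\mathcal{A},\ \forall k>n\}$ (with $0\in\mathbb N$; $\infty$ if no such $n$), and $\mathrm{id}_{\mathcal{A}}(\mathcal{B}):=\sup\{\mathrm{id}_{\mathcal{A}}(B) : B\in\mathcal{B}\}$. $\nu$ is $\mathcal{Z}$-injective if $\mathrm{id}_{\mathcal{Z}}(\nu)=0$. A class is left thick if it is closed under extensions, direct summands and epi-kernels, where $\mathcal{M}$ is closed under epi-kernels if for every exact sequence $0\to M''\to M'\to M\to0$ with $M',M\in\mathcal{M}$ one has $M''\in\mathcal{M}$. For classes $\mathcal{P},\mathcal{Q}\subseteq\mathcal{C}$ and $M\in\mathcal{C}$: a $\mathcal{Q}_{\mathcal{P}}$-coresolution of $M$ is an exact sequence $0\to M\xrightarrow{f_0}Q_0\xrightarrow{f_1}Q_1\to\cdots\to Q_{n-1}\xrightarrow{f_n}Q_n\to\cdots$ with $Q_k\in\mathcal{Q}\cup\{0\}$ for all $k\ge0$ and $\mathrm{Im}(f_i)\in\mathcal{P}\cup\{0\}$ for all $i\ge1$. A $\mathcal{Q}_{\mathcal{P}}$-coresolution of length $n$ of $M$ is an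 exact sequence $0\to M\xrightarrow{f_0}Q_0\xrightarrow{f_1}Q_1\to\cdots\xrightarrow{f_n}Q_n\to0$ with $Q_n\in\mathcal{P}\cap\mathcal{Q}$, $Q_k\in\mathcal{Q}$ for $0\le k\le n-1$, and $\mathrm{Im}(f_i)\in\mathcal{P}$ for $1\le i\le n-1$. $\mathrm{coresdim}_{\mathcal{Q}}^{\mathcal{P}}(M)$ is the smallest $n\ge0$ such that $M$ has a $\mathcal{Q}_{\mathcal{P}}$-coresolution of length $n$ ($\infty$ if none). $\mathcal{Q}_{\mathcal{P},\infty}^{\vee}$ (resp. $\mathcal{Q}_{\mathcal{P}}^{\vee}$) is the class of all objects having a $\mathcal{Q}_{\mathcal{P}}$-coresolution (resp. one of some finite length). Finally, $(\mathcal{P},\mathcal{Q})_{\infty}^{\vee}:=\mathcal{P}\cap\mathcal{Q}_{\mathcal{P},\infty}^{\vee}$ and $(\mathcal{P},\mathcal{Q})^{\vee}:=\mathcal{P}\cap\mathcal{Q}_{\mathcal{P}}^{\vee}$. *)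

(* Defs.v *)
From Stdlib Require Import Relation_Operators.
From mathcomp Require Import all_boot all_order all_algebra.
From mathcomp Require Import boolp classical_sets.

Set Implicit Arguments.
Unset Strict Implicit.
Unset Printing Implicit Defensive.

Local Open Scope classical_set_scope.
Local Open Scope ring_scope.

(* None is infinity. *)
Definition enat := option nat.
Definition enat_infty : enat := None.

Definition enat_le (x y : enat) : bool :=
  match x, y with
  | _, None => true
  | None, Some _ => false
  | Some m, Some n => (m <= n)%N
  end.

Definition enat_min (P : set nat) : enat :=
  match pselect (exists n, `[< P n >]) with
  | left h => Some (ex_minn h)
  | right _ => enat_infty
  end.

(* Least upper bound; the supremum of the empty set is 0. *)
Definition enat_sup (S : set enat) : enat :=
  enat_min [set n | forall x, S x -> enat_le x (Some n)].

Record preadditiveCat := Preadditive {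
  obj :> Type;
  hom : obj -> obj -> zmodType;
  idm : forall A, hom A A;
  compm : forall A B D, hom B D -> hom A B -> hom A D;
  compmA : forall A B D E (h : hom D E) (g : hom B D) (f : hom A B),
    compm h (compm g f) = compm (compm h g) f;
  comp1m : forall A B (f : hom A B), compm (idm B) f = f;
  compm1 : forall A B (f : hom A B), compm f (idm A) = f;
  compmDl : forall A B D (g g' : hom B D) (f : hom A B),
    compm (g + g') f = compm g f + compm g' f;
  compmDr : forall A B D (g : hom B D) (f f' : hom A B),
    compm g (f + f') = compm g f + compm g f'
}.

Arguments hom {p} A B.
Arguments idm {p} A.
Arguments compm {p A B D} g f.

Notation "g \oc f" := (compm g f) (at level 50, left associativity).

Section Categories.
Context {C : preadditiveCat}.
Implicit Types A B D M : C.

Definition is_mono A B (f : hom A B) : Prop :=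
  forall X (g h : hom X A), f \oc g = f \oc h -> g = h.

Definition is_epi A B (f : hom A B) : Prop :=
  forall X (g h : hom B X), g \oc f = h \oc f -> g = h.

Definition isom A B (f : hom A B) : Prop :=
  exists g : hom B A, g \oc f = idm A /\ f \oc g = idm B.

Definition is_zero A : Prop :=
  forall X, (forall f : hom A X, f = 0) /\ (forall f : hom X A, f = 0).

Definition is_kernel A B (f : hom A B) K (k : hom K A) : Prop :=
  f \oc k = 0 /\
  forall X (g : hom X A), f \oc g = 0 -> exists! u : hom X K, k \oc u = g.

Definition is_cokernel A B (f : hom A B) Q (q : hom B Q) : Prop :=
  q \oc f = 0 /\
  forall X (g : hom B X), g \oc f = 0 -> exists! u : hom Q X, u \oc q = g.

Definition is_coproduct (I : Type) (X : I -> C) S : Prop :=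
  exists inj : forall i, hom (X i) S,
    forall T (f : forall i, hom (X i) T),
      exists! u : hom S T, forall i, u \oc inj i = f i.

Definition is_sum A B S : Prop := is_coproduct (fun b : bool => if b then A else B) S.

Definition is_image A B (f : hom A B) I (i : hom I B) : Prop :=
  exists Q (q : hom B Q), is_cokernel f q /\ is_kernel q i.

(* Im f = Ker g as subobjects of B. *)
Definition is_exact A B D (f : hom A B) (g : hom B D) : Prop :=
  exists I (i : hom I B), is_image f i /\ is_kernel g i.

Definition short_exact A B D (f : hom A B) (g : hom B D) : Prop :=
  [/\ is_mono f, is_exact f g & is_epi g].

End Categories.

Record abelianCat := Abelian {
  abelian_base :> preadditiveCat;
  has_zero : exists O : abelian_base, is_zero O;
  has_sums : forall A B : abelian_base, exists S, is_sum A B S;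
  has_kernels : forall (A B : abelian_base) (f : hom A B),
    exists K (k : hom K A), is_kernel f k;
  has_cokernels : forall (A B : abelian_base) (f : hom A B),
    exists Q (q : hom B Q), is_cokernel f q;
  mono_normal : forall (A B : abelian_base) (f : hom A B), is_mono f ->
    exists D (g : hom B D), is_kernel g f;
  epi_normal : forall (A B : abelian_base) (f : hom A B), is_epi f ->
    exists D (g : hom D A), is_cokernel g f
}.

Section Classes.
Context {C : abelianCat}.
Implicit Types (A B M N : C) (P Q X Y : set C).

Definition zero_objects : set C := [set A | is_zero A].

Definition smd X : set C := [set A | exists B M, is_sum A B M /\ X M].

Definition add_class X : set C :=
  smd [set S | exists n (F : 'I_n -> C), (forall i, X (F i)) /\ is_coproduct F S].

Definition closed_summands X : Prop := smd X `<=` X.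

Definition closed_extensions X : Prop :=
  forall A B D (f : hom A B) (g : hom B D), short_exact f g ->
    X A -> X D -> X B.

Definition closed_epi_kernels X : Prop :=
  forall A B D (f : hom A B) (g : hom B D), short_exact f g ->
    X B -> X D -> X A.

Definition left_thick X : Prop :=
  [/\ closed_extensions X, closed_summands X & closed_epi_kernels X].

(* A finite sequence 0 -> M -> E_0 -> ... -> E_n -> 0 is represented by
   the infinite sequence obtained by continuing it with zero objects. *)
Record cosequence M := Cosequence {
  cterm : nat -> C;
  caug : hom M (cterm 0%N);
  cdiff : forall i, hom (cterm i) (cterm i.+1)
}.

Definition exact_cosequence M (s : cosequence M) : Prop :=
  [/\ is_mono (caug s), is_exact (caug s) (cdiff s 0%N)
    & forall i, is_exact (cdiff s i) (cdiff s i.+1)].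

Definition ends_at (n : nat) M (s : cosequence M) : Prop :=
  forall i, (n < i)%N -> is_zero (cterm s i).

(* For k >= 1, a k-extension 0 -> M -> E_0 -> ... -> E_(k-1) -> A -> 0;
   the object in position k is identified with A by an isomorphism. *)
Record extension (k : nat) A M := Extension {
  ext_seq : cosequence M;
  ext_end : hom (cterm ext_seq k) A;
  ext_exact : exact_cosequence ext_seq;
  ext_ends : ends_at k ext_seq;
  ext_endP : isom ext_end
}.

Definition extension_morphism k A M (s t : extension k A M) : Prop :=
  exists h : forall i, hom (cterm (ext_seq s) i) (cterm (ext_seq t) i),
    [/\ h 0%N \oc caug (ext_seq s) = caug (ext_seq t),
        forall i, h i.+1 \oc cdiff (ext_seq s) i = cdiff (ext_seq t) i \oc h i
      & ext_end t \oc h k = ext_end s].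

Definition yoneda_equiv k A M : extension k A M -> extension k A M -> Prop :=
  clos_refl_sym_trans (extension k A M) (@extension_morphism k A M).

(* Ext^k(A, M) = 0. For k >= 1, Ext^k(A, M) is the group of k-extensions
   modulo Yoneda equivalence; it is zero iff it has a single element. *)
Definition Ext_eq0 (k : nat) A M : Prop :=
  if k is 0 then forall f : hom A M, f = 0
  else forall s t : extension k A M, yoneda_equiv s t.

Definition idim X M : enat :=
  enat_min [set n | forall A, X A -> forall k, (n < k)%N -> Ext_eq0 k A M].

Definition idim_class X Y : enat := enat_sup [set idim X M | M in Y].

Definition relatively_injective X Y : Prop := idim_class X Y = Some 0%N.

Definition image_in P A B (f : hom A B) : Prop :=
  exists I (i : hom I B), is_image f i /\ P I.

(* With 0 -> M -f_0-> Q_0 -f_1-> Q_1 -> ..., f_0 is caug s and f_(i+1) is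
   cdiff s i. *)
Definition has_coresolution P Q M : Prop :=
  exists s : cosequence M,
    [/\ exact_cosequence s,
        forall k, (Q `|` zero_objects) (cterm s k)
      & forall i, image_in (P `|` zero_objects) (cdiff s i)].

Definition has_coresolution_of_length P Q (n : nat) M : Prop :=
  exists s : cosequence M,
    [/\ exact_cosequence s,
        ends_at n s,
        (P `&` Q) (cterm s n),
        forall k, (k < n)%N -> Q (cterm s k)
      & forall i, (i.+1 < n)%N -> image_in P (cdiff s i)].

Definition coresdim P Q M : enat :=
  enat_min [set n | has_coresolution_of_length P Q n M].

Definition coresolved_inf P Q : set C := [set M | has_coresolution P Q M].

Definition coresolved P Q : set C :=
  [set M | exists n, has_coresolution_of_length P Q n M].

(* (P, Q)_oo^\vee and (P, Q)^\vee, whose coresolutions have terms in Q and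
   images in P. *)
Definition vee_inf P Q : set C := P `&` coresolved_inf P Q.
Definition vee P Q : set C := P `&` coresolved P Q.

End Classes.

(* Main.v *)
(* The classes only enter through elementary short exact sequence arguments
   (horseshoe, third isomorphism) once one knows the long exact sequence for
   Yoneda Ext in the form of three vanishing statements.  These are obtained
   without Baer sums: fixing A, an element of Ext^k(A, M) is a string of k short
   exact sequences starting at M ended by a map from A, up to the equivalence
   generated by morphisms.  Such an element, with first sequence 0 -> M -> E -> K
   -> 0 and remainder x in Ext^(k-1)(A, K), is declared to vanish when x lifts to
   Ext^(k-1)(A, E).  That this is invariant under equivalence is proved by
   induction on k together with exactness at the middle term: a morphism of short
   exact sequences which is the identity on M yields a short exact sequence
   0 -> E -> E' + K -> K' -> 0, to which middle exactness one degree lower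
   applies.

   (Z, nu)_oo is then the largest subclass Y of Z each of whose objects M fits
   in 0 -> M -> Q -> M' -> 0 with Q in nu and M' in Y, and dimension shifting
   shows that M in it has a coresolution of length n iff Ext^k(-, M) vanishes on
   it for k > n.  Closure of (Z, nu) follows from that of (Z, nu)_oo by the long
   exact sequence. *)
Require Import Defs.
From Stdlib Require Import Relation_Operators.
From mathcomp Require Import all_boot ssralg.
From mathcomp Require Import boolp classical_sets.

Set Implicit Arguments.
Unset Strict Implicit.
Unset Printing Implicit Defensive.

Import GRing.Theory.

Local Open Scope classical_set_scope.

(** * Preadditive and abelian categories *)

Section Preadditive.
Local Open Scope ring_scope.
Context {C : preadditiveCat}.
Implicit Types A B D E K M : C.

Lemma comp0m A B D (f : hom A B) : (0 : hom B D) \oc f = 0.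
Proof. by apply: (@addrI _ (0 \oc f)); rewrite -compmDl !addr0. Qed.

Lemma compm0 A B D (g : hom B D) : g \oc (0 : hom A B) = 0.
Proof. by apply: (@addrI _ (g \oc 0)); rewrite -compmDr !addr0. Qed.

Lemma compNm A B D (g : hom B D) (f : hom A B) : (- g) \oc f = - (g \oc f).
Proof. by apply: (@addrI _ (g \oc f)); rewrite -compmDl !subrr comp0m. Qed.

Lemma compmN A B D (g : hom B D) (f : hom A B) : g \oc (- f) = - (g \oc f).
Proof. by apply: (@addrI _ (g \oc f)); rewrite -compmDr !subrr compm0. Qed.

Lemma compmBl A B D (g g' : hom B D) (f : hom A B) :
  (g - g') \oc f = (g \oc f) - (g' \oc f).
Proof. by rewrite compmDl compNm. Qed.

Lemma compmBr A B D (g : hom B D) (f f' : hom A B) :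
  g \oc (f - f') = (g \oc f) - (g \oc f').
Proof. by rewrite compmDr compmN. Qed.

Lemma mono0P A B (f : hom A B) :
  is_mono f <-> forall X (x : hom X A), f \oc x = 0 -> x = 0.
Proof.
split=> [mf X x fx|H X g h e]; first by apply: mf; rewrite fx compm0.
by apply/eqP; rewrite -subr_eq0; apply/eqP/H; rewrite compmBr e subrr.
Qed.

Lemma epi0P A B (f : hom A B) :
  is_epi f <-> forall X (x : hom B X), x \oc f = 0 -> x = 0.
Proof.
split=> [mf X x fx|H X g h e]; first by apply: mf; rewrite fx comp0m.
by apply/eqP; rewrite -subr_eq0; apply/eqP/H; rewrite compmBl e subrr.
Qed.

Lemma mono_id A : is_mono (idm A).
Proof. by move=> X g h; rewrite !comp1m. Qed.

Lemma epi_id A : is_epi (idm A).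
Proof. by move=> X g h; rewrite !compm1. Qed.

Lemma mono_comp A B D (g : hom B D) (f : hom A B) :
  is_mono g -> is_mono f -> is_mono (g \oc f).
Proof. by move=> mg mf X x y; rewrite -!compmA => /mg/mf. Qed.

Lemma kernelP A B K (f : hom A B) (k : hom K A) :
  is_kernel f k <->
  [/\ f \oc k = 0, is_mono k
    & forall X (x : hom X A), f \oc x = 0 -> exists u, k \oc u = x].
Proof.
split=> [[fk ker]|[fk mk ker]].
  split=> //; last by move=> X x /ker[u [<- _]]; exists u.
  move=> X g h e; have [|u [_ uu]] := ker X (k \oc g).
    by rewrite compmA fk comp0m.
  by rewrite -(uu g) // -(uu h).
split=> // X x /ker[u ux]; exists u; split=> // v vx.
by apply: mk; rewrite ux vx.
Qed.

Lemma cokernelP A B Q (f : hom A B) (q : hom B Q) :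
  is_cokernel f q <->
  [/\ q \oc f = 0, is_epi q
    & forall X (x : hom B X), x \oc f = 0 -> exists u, u \oc q = x].
Proof.
split=> [[fk ker]|[fk mk ker]].
  split=> //; last by move=> X x /ker[u [<- _]]; exists u.
  move=> X g h e; have [|u [_ uu]] := ker X (g \oc q).
    by rewrite -compmA fk compm0.
  by rewrite -(uu g) // -(uu h).
split=> // X x /ker[u ux]; exists u; split=> // v vx.
by apply: mk; rewrite ux vx.
Qed.

Lemma isom_id A : isom (idm A).
Proof. by exists (idm A); rewrite compm1. Qed.

Lemma zeroP A : is_zero A <-> idm A = 0.
Proof.
split=> [/(_ A)[] /(_ (idm A)) //|e X]; split=> f.
  by rewrite -(compm1 f) e compm0.
by rewrite -(comp1m f) e comp0m.
Qed.

Lemma zero_from A B (f : hom A B) : is_zero A -> f = 0.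
Proof. by case/(_ B) => /(_ f). Qed.

Lemma zero_to A B (f : hom A B) : is_zero B -> f = 0.
Proof. by case/(_ A) => _ /(_ f). Qed.

Record biproduct A B S := Biproduct {
  in1 : hom A S; in2 : hom B S; pr1 : hom S A; pr2 : hom S B;
  pr1in1 : pr1 \oc in1 = idm A;
  pr1in2 : pr1 \oc in2 = 0;
  pr2in1 : pr2 \oc in1 = 0;
  pr2in2 : pr2 \oc in2 = idm B;
  in_pr : (in1 \oc pr1) + (in2 \oc pr2) = idm S
}.

Section Biproduct.
Context {A B S : C} (b : biproduct A B S).

Definition pairm X (f : hom X A) (g : hom X B) : hom X S :=
  (in1 b \oc f) + (in2 b \oc g).
Definition copairm X (f : hom A X) (g : hom B X) : hom S X :=
  (f \oc pr1 b) + (g \oc pr2 b).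

Lemma pr1_pair X (f : hom X A) (g : hom X B) : pr1 b \oc pairm f g = f.
Proof. by rewrite compmDr !compmA pr1in1 pr1in2 comp1m comp0m addr0. Qed.

Lemma pr2_pair X (f : hom X A) (g : hom X B) : pr2 b \oc pairm f g = g.
Proof. by rewrite compmDr !compmA pr2in1 pr2in2 comp1m comp0m add0r. Qed.

Lemma copair_in1 X (f : hom A X) (g : hom B X) : copairm f g \oc in1 b = f.
Proof. by rewrite compmDl -!compmA pr1in1 pr2in1 compm1 compm0 addr0. Qed.

Lemma copair_in2 X (f : hom A X) (g : hom B X) : copairm f g \oc in2 b = g.
Proof. by rewrite compmDl -!compmA pr1in2 pr2in2 compm1 compm0 add0r. Qed.

Lemma pair_uniq X (f g : hom X S) :
  pr1 b \oc f = pr1 b \oc g -> pr2 b \oc f = pr2 b \oc g -> f = g.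
Proof.
move=> e1 e2; rewrite -(comp1m f) -(comp1m g) -(in_pr b) !compmDl -!compmA.
by rewrite e1 e2.
Qed.

Lemma copair_uniq X (f g : hom S X) :
  f \oc in1 b = g \oc in1 b -> f \oc in2 b = g \oc in2 b -> f = g.
Proof.
move=> e1 e2; rewrite -(compm1 f) -(compm1 g) -(in_pr b) !compmDr !compmA.
by rewrite e1 e2.
Qed.

Lemma pair_comp X Y (f : hom X A) (g : hom X B) (h : hom Y X) :
  pairm f g \oc h = pairm (f \oc h) (g \oc h).
Proof. by rewrite /pairm compmDl !compmA. Qed.

Lemma copair_comp X Y (f : hom A X) (g : hom B X) (h : hom X Y) :
  h \oc copairm f g = copairm (h \oc f) (h \oc g).
Proof. by rewrite /copairm compmDr !compmA. Qed.

Lemma copair_pair X Y (f : hom A X) (g : hom B X) (h : hom Y A) (k : hom Y B) :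
  copairm f g \oc pairm h k = (f \oc h) + (g \oc k).
Proof. by rewrite /pairm compmDr !compmA copair_in1 copair_in2. Qed.

End Biproduct.

Lemma is_sumP A B S : is_sum A B S <-> inhabited (biproduct A B S).
Proof.
split.
  case=> inj H; pose i1 : hom A S := inj true; pose i2 : hom B S := inj false.
  have Hex T (f : hom A T) (g : hom B T) :
      exists u : hom S T, u \oc i1 = f /\ u \oc i2 = g.
    have [u [Hu _]] := H T (fun c =>
      match c as c return hom (if c then A else B) T with
      | true => f | false => g end).
    by exists u; split; [exact: (Hu true) | exact: (Hu false)].
  have Hun T (u v : hom S T) :
      u \oc i1 = v \oc i1 -> u \oc i2 = v \oc i2 -> u = v.
    move=> e1 e2; have [w [_ Hw]] := H T (fun b => v \oc inj b).
    by rewrite -(Hw u) ?(Hw v) //; case.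
  have [p1 [p11 p12]] := Hex _ (idm A) 0.
  have [p2 [p21 p22]] := Hex _ 0 (idm B).
  split; apply: (@Biproduct _ _ _ i1 i2 p1 p2) => //.
  apply: Hun; rewrite compmDl -!compmA.
    by rewrite p11 p21 compm1 compm0 addr0 comp1m.
  by rewrite p12 p22 compm1 compm0 add0r comp1m.
case=> b; exists (fun c => match c as c return hom (if c then A else B) S with
  | true => in1 b | false => in2 b end).
move=> T f; exists (copairm b (f true) (f false)); split.
  by case; rewrite ?copair_in1 ?copair_in2.
move=> v Hv; apply: (copair_uniq (b := b)).
  by rewrite copair_in1 -(Hv true).
by rewrite copair_in2 -(Hv false).
Qed.

Definition biproduct_sym A B S (b : biproduct A B S) : biproduct B A S.
Proof.
apply: (@Biproduct _ _ _ (in2 b) (in1 b) (pr2 b) (pr1 b)); case: b => //=.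
by move=> *; rewrite addrC.
Defined.

Lemma biproduct_zero A O : is_zero O -> biproduct A O A.
Proof.
move=> zO; apply: (@Biproduct _ _ _ (idm A) 0 (idm A) 0);
  rewrite ?compm0 ?compm1 ?addr0 //.
by rewrite ((zeroP O).1 zO).
Qed.

End Preadditive.

(** * Pullbacks, pushouts and chases through epimorphic covers *)

Section Abelian.
Local Open Scope ring_scope.
Context {C : abelianCat}.
Implicit Types A B D E K M : C.

Definition bsum A B : C := sval (cid (has_sums A B)).
Definition bsumb A B : biproduct A B (bsum A B).
Proof.
apply: inhabited_witness; apply/is_sumP.
exact: (svalP (cid (has_sums A B))).
Qed.

Definition zobj : C := sval (cid (has_zero C)).
Lemma zobjP : is_zero zobj. Proof. exact: (svalP (cid (has_zero C))). Qed.

Definition ses M E K (i : hom M E) (p : hom E K) : Prop :=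
  is_mono i /\ is_cokernel i p.

Lemma mono_kernel A B Q (f : hom A B) (q : hom B Q) :
  is_mono f -> is_cokernel f q -> is_kernel q f.
Proof.
move=> mf /cokernelP[qf eq cq]; have [D [g /kernelP[gf _ kg]]] := mono_normal mf.
apply/kernelP; split=> // X x qx; apply: kg.
by have [g' <-] := cq _ _ gf; rewrite -compmA qx compm0.
Qed.

Lemma epi_cokernel A B K (f : hom A B) (k : hom K A) :
  is_epi f -> is_kernel f k -> is_cokernel k f.
Proof.
move=> ef /kernelP[fk mk kk]; have [D [g /cokernelP[fg _ cg]]] := epi_normal ef.
apply/cokernelP; split=> // X x xk; apply: cg.
by have [g' <-] := kk _ _ fg; rewrite compmA xk comp0m.
Qed.

Section Ses.
Context {M E K : C} {i : hom M E} {p : hom E K} (s : ses i p).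

Lemma ses_mono : is_mono i. Proof. by case: s. Qed.
Lemma ses_coker : is_cokernel i p. Proof. by case: s. Qed.
Lemma ses_epi : is_epi p. Proof. by have /cokernelP[] := ses_coker. Qed.
Lemma ses_comp0 : p \oc i = 0. Proof. by have /cokernelP[] := ses_coker. Qed.
Lemma ses_ker : is_kernel p i. Proof. by case: s => *; apply: mono_kernel. Qed.

Lemma ses_lift X (x : hom X E) : p \oc x = 0 -> exists u, i \oc u = x.
Proof. by have /kernelP[_ _] := ses_ker; apply. Qed.

Lemma ses_desc X (x : hom E X) : x \oc i = 0 -> exists u, u \oc p = x.
Proof. by have /cokernelP[_ _] := ses_coker; apply. Qed.

End Ses.

Lemma mono_ses M E (i : hom M E) : is_mono i -> exists K (p : hom E K), ses i p.
Proof. by move=> mi; have [K [p cp]] := has_cokernels i; exists K, p. Qed.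

Lemma kernel_ses M E K (i : hom M E) (p : hom E K) :
  is_epi p -> is_kernel p i -> ses i p.
Proof.
by move=> ep kp; split; [case/kernelP: kp | apply: epi_cokernel].
Qed.

Lemma epi_ses E K (p : hom E K) : is_epi p -> exists M (i : hom M E), ses i p.
Proof.
by move=> ep; have [M [i kp]] := has_kernels p; exists M, i; apply: kernel_ses.
Qed.

(** A lift that exists after an epi cover [c] descends: it kills the kernel of [c], because its
    composite with the mono [f] does. *)
Lemma mono_lift_cover A B X Y (f : hom A B) (x : hom X B) (c : hom Y X) y :
  is_mono f -> is_epi c -> f \oc y = x \oc c -> exists u, f \oc u = x.
Proof.
move=> mf ec e; have [K [k s]] := epi_ses ec.
have [|u uc] := ses_desc s (x := y).
  by apply: mf; rewrite compmA e -compmA (ses_comp0 s) !compm0.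
by exists u; apply: ec; rewrite -compmA uc e.
Qed.

Lemma mono_epi_isom A B (f : hom A B) : is_mono f -> is_epi f -> isom f.
Proof.
move=> mf ef; have [u fu] : exists u, f \oc u = idm B.
  by apply: (mono_lift_cover (y := idm A) mf ef); rewrite comp1m compm1.
by exists u; split=> //; apply: mf; rewrite compmA fu compm1 comp1m.
Qed.

(** The pullback is the kernel of [(p, -a)] on the sum of [E] and [A]. If [x] kills [r], then [x]
    composed with [pr2] factors through [(p, -a)] by some [u] with [u \oc p = 0]; as [p] is epi, [u]
    and then [x] vanish. *)
Lemma pullback M E K A (i : hom M E) (p : hom E K) (a : hom A K) : ses i p ->
  exists P (j : hom M P) (e : hom P E) (r : hom P A),
  [/\ ses j r, e \oc j = i, p \oc e = a \oc r
    & forall T (x : hom T E) (y : hom T A), p \oc x = a \oc y ->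
      exists u, e \oc u = x /\ r \oc u = y].
Proof.
move=> s; pose b := bsumb E A.
have ed : is_epi (copairm b p (- a)).
  move=> X x y e; apply: (ses_epi s).
  by rewrite -(copair_in1 b p (- a)) !compmA e.
have [P [m sP]] := epi_ses ed.
have lift T (x : hom T E) (y : hom T A) : p \oc x = a \oc y ->
      exists u, pr1 b \oc m \oc u = x /\ pr2 b \oc m \oc u = y.
  move=> exy; have [|u mu] := ses_lift sP (x := pairm b x y).
    by rewrite copair_pair compNm exy subrr.
  by exists u; rewrite -!compmA mu pr1_pair pr2_pair.
have sq : p \oc (pr1 b \oc m) = a \oc (pr2 b \oc m).
  apply/eqP; rewrite -subr_eq0 -compNm !compmA -compmDl.
  by rewrite -/(copairm b p (- a)) (ses_comp0 sP).
have [j [ej rj]] : exists u, pr1 b \oc m \oc u = i /\ pr2 b \oc m \oc u = 0.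
  by apply: lift; rewrite (ses_comp0 s) compm0.
exists P, j, (pr1 b \oc m), (pr2 b \oc m); split=> //.
apply: kernel_ses.
  apply/epi0P => X x; rewrite compmA => xe.
  have [|u] := ses_desc sP (x := x \oc pr2 b).
    by [].
  rewrite copair_comp => ue.
  have : u \oc p = 0.
    by rewrite -(copair_in1 b (u \oc p) (u \oc (- a))) ue -compmA pr2in1 compm0.
  rewrite -{1}(comp0m X p) => /(ses_epi s) u0.
  by rewrite -(compm1 x) -(pr2in2 b) compmA -ue u0 !comp0m copair_in2.
apply/kernelP; split=> //.
  move=> X x y e; apply: (ses_mono s); by rewrite -ej -!compmA e.
move=> X x rx; have [|u iu] := ses_lift s (x := pr1 b \oc m \oc x).
  by rewrite compmA sq -compmA rx compm0.
exists u; apply: (ses_mono sP); apply: (pair_uniq (b := b)).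
  by rewrite !compmA ej iu.
by rewrite !compmA rj rx comp0m.
Qed.

(** Substitute for choosing a preimage of an element: a generalized element lifts along an epi after
    passing to a cover. The chases below rest on it. *)
Lemma epi_cover A B X (f : hom A B) (x : hom X B) : is_epi f ->
  exists Y (c : hom Y X) (y : hom Y A), is_epi c /\ f \oc y = x \oc c.
Proof.
move=> ef; have [M [i s]] := epi_ses ef.
have [P [j [e [r [sr _ sq _]]]]] := pullback x s.
by exists P, r, e; split=> //; apply: (ses_epi sr).
Qed.

(** Dual construction: the cokernel of [(i, -g)] into the sum of [E] and [M']. *)
Lemma pushout M E K M' (i : hom M E) (p : hom E K) (g : hom M M') : ses i p ->
  exists P (j : hom M' P) (e : hom E P) (r : hom P K),
  [/\ ses j r, e \oc i = j \oc g, r \oc e = p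
    & forall T (x : hom E T) (y : hom M' T), x \oc i = y \oc g ->
      exists u, u \oc e = x /\ u \oc j = y].
Proof.
move=> s; pose b := bsumb E M'.
have md : is_mono (pairm b i (- g)).
  move=> X x y e; apply: (ses_mono s).
  by rewrite -(pr1_pair b i (- g)) -!compmA e.
have [P [m sP]] := mono_ses md.
have desc T (x : hom E T) (y : hom M' T) : x \oc i = y \oc g ->
      exists u, u \oc (m \oc in1 b) = x /\ u \oc (m \oc in2 b) = y.
  move=> exy; have [|u mu] := ses_desc sP (x := copairm b x y).
    by rewrite copair_pair compmN exy subrr.
  by exists u; rewrite !compmA mu copair_in1 copair_in2.
have sq : m \oc in1 b \oc i = m \oc in2 b \oc g.
  apply/eqP; rewrite -subr_eq0 -compmN -!compmA -compmDr.
  by rewrite -/(pairm b i (- g)) (ses_comp0 sP).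
have [r [re rj]] : exists u, u \oc (m \oc in1 b) = p /\ u \oc (m \oc in2 b) = 0.
  by apply: desc; rewrite (ses_comp0 s) comp0m.
exists P, (m \oc in2 b), (m \oc in1 b), r; split=> //; split.
  apply/mono0P => X x; rewrite -compmA => /(ses_lift sP)[u eu].
  have iu : i \oc u = 0.
    by rewrite -(pr1_pair b i (- g)) -compmA eu compmA pr1in2 comp0m.
  move: iu; rewrite -{1}(compm0 X i) => /(ses_mono s) u0.
  by rewrite -(comp1m x) -(pr2in2 b) -compmA -eu u0 !compm0.
apply/cokernelP; split=> //.
  by move=> X x y e; apply: (ses_epi s); rewrite -re !compmA e.
move=> X x xj; have [|u pu] := ses_desc s (x := x \oc (m \oc in1 b)).
  by rewrite -compmA sq compmA xj comp0m.
exists u; apply: (ses_epi sP); apply: (copair_uniq (b := b)).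
  by rewrite -!compmA re pu.
by rewrite -!compmA rj xj compm0.
Qed.

End Abelian.

(** * Diagram lemmas for short exact sequences *)

Section ShortExact.
Local Open Scope ring_scope.
Context {C : abelianCat}.
Implicit Types A B D E K M : C.

Lemma ses_id A O : is_zero O -> ses (idm A) (0 : hom A O).
Proof.
move=> zO; split; first exact: mono_id.
apply/cokernelP; split; first by rewrite comp0m.
  by apply/epi0P => X x _; apply: zero_from.
by move=> X x; rewrite compm1 => ->; exists 0; rewrite comp0m.
Qed.

Lemma ses_biproduct A B S (b : biproduct A B S) : ses (in1 b) (pr2 b).
Proof.
split.
  by move=> X x y e; rewrite -(comp1m x) -(comp1m y) -(pr1in1 b) -!compmA e.
apply/cokernelP; split; first exact: pr2in1.
  by move=> X x y e; rewrite -(compm1 x) -(compm1 y) -(pr2in2 b) !compmA e.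
move=> X x x1; exists (x \oc in2 b); apply: (copair_uniq (b := b)).
  by rewrite -compmA pr2in1 compm0 x1.
by rewrite -compmA pr2in2 compm1.
Qed.

Lemma ses_prod A B D A' B' D' (i : hom A B) (p : hom B D) (i' : hom A' B')
    (p' : hom B' D') S T U (a : biproduct A A' S) (b : biproduct B B' T)
    (d : biproduct D D' U) : ses i p -> ses i' p' ->
  ses (pairm b (i \oc pr1 a) (i' \oc pr2 a))
      (pairm d (p \oc pr1 b) (p' \oc pr2 b)).
Proof.
move=> s s'; apply: kernel_ses.
  move=> X x y e; apply: (copair_uniq (b := d)).
    apply: (ses_epi s); have := congr1 (fun z => z \oc in1 b) e => /=.
    rewrite -!compmA pair_comp -!compmA pr1in1 pr2in1 !compm0 compm1.
    by rewrite /pairm compm0 addr0 !compmA.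
  apply: (ses_epi s'); have := congr1 (fun z => z \oc in2 b) e => /=.
  rewrite -!compmA pair_comp -!compmA pr1in2 pr2in2 !compm0 compm1.
  by rewrite /pairm compm0 add0r !compmA.
apply/kernelP; split.
- rewrite pair_comp -!compmA pr1_pair pr2_pair !compmA (ses_comp0 s).
  by rewrite (ses_comp0 s') /pairm !comp0m !compm0 addr0.
- move=> X x y e; apply: (pair_uniq (b := a)).
    apply: (ses_mono s); have := congr1 (fun z => pr1 b \oc z) e => /=.
    by rewrite !compmA !pr1_pair.
  apply: (ses_mono s'); have := congr1 (fun z => pr2 b \oc z) e => /=.
  by rewrite !compmA !pr2_pair.
move=> X x; rewrite pair_comp => e.
have [|u eu] := ses_lift s (x := pr1 b \oc x).
  by rewrite compmA -(pr1_pair d (p \oc pr1 b \oc x) (p' \oc pr2 b \oc x)) e compm0.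
have [|v ev] := ses_lift s' (x := pr2 b \oc x).
  by rewrite compmA -(pr2_pair d (p \oc pr1 b \oc x) (p' \oc pr2 b \oc x)) e compm0.
exists (pairm a u v); apply: (pair_uniq (b := b)).
  by rewrite compmA pr1_pair -compmA pr1_pair.
by rewrite compmA pr2_pair -compmA pr2_pair.
Qed.

Lemma third_iso A B D E E1 K (j : hom A B) (q : hom B D) (i : hom B E)
    (p : hom E K) (e1 : hom E E1) :
  ses j q -> ses i p -> ses (i \oc j) e1 ->
  exists (c : hom D E1) (r : hom E1 K),
    [/\ ses c r, e1 \oc i = c \oc q & r \oc e1 = p].
Proof.
move=> sj si s1.
have [|c ec] := ses_desc sj (x := e1 \oc i).
  by rewrite -compmA (ses_comp0 s1).
have [|r er] := ses_desc s1 (x := p).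
  by rewrite compmA (ses_comp0 si) comp0m.
exists c, r; split=> //; split.
  (* Lift [x] to [y] in [B] on a cover. Its image in [E] dies in [E1], so [y] comes from [A] and
     maps to 0 in [D]. *)
  apply/mono0P => X x cx; have [Y [h [y [eh ey]]]] := epi_cover x (ses_epi sj).
  have [|z iz] := ses_lift s1 (x := i \oc y).
    by rewrite compmA -ec -compmA ey compmA cx comp0m.
  apply: eh; rewrite comp0m -ey.
  have -> : y = j \oc z by apply: (ses_mono si); rewrite compmA.
  by rewrite compmA (ses_comp0 sj) comp0m.
apply/cokernelP; split.
- apply: (ses_epi sj); rewrite -compmA ec compmA er comp0m; exact: ses_comp0.
- by move=> X x y e; apply: (ses_epi si); rewrite -er !compmA e.
move=> X x xc; have [|u eu] := ses_desc si (x := x \oc e1).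
  by rewrite -compmA -ec compmA xc comp0m.
by exists u; apply: (ses_epi s1); rewrite -compmA er.
Qed.

(** When both maps out of [M] are mono, the pushout sits in two short exact sequences, one for each
    leg, with the original cokernels. *)
Lemma pushout_mono M E K Q M' (i : hom M E) (p : hom E K) (g : hom M Q)
    (q : hom Q M') : ses i p -> ses g q ->
  exists P (j : hom Q P) (e : hom E P) (r : hom P K) (u : hom P M'),
  [/\ ses j r, ses e u, e \oc i = j \oc g, r \oc e = p & u \oc j = q].
Proof.
move=> s sg; have [P [j [e [r [sj sq re univ]]]]] := pushout g s.
have [|u [ue uj]] := univ _ (0 : hom E M') q.
  by rewrite comp0m (ses_comp0 sg).
exists P, j, e, r, u; split=> //; split.
  apply/mono0P => X x ex; have [|y ey] := ses_lift s (x := x).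
    by rewrite -re -compmA ex compm0.
  have : j \oc (g \oc y) = 0 by rewrite compmA -sq -compmA ey.
  move/((mono0P j).1 (ses_mono sj))/((mono0P g).1 (ses_mono sg)) => y0.
  by rewrite -ey y0 compm0.
apply/cokernelP; split=> //.
  by move=> X x y e'; apply: (ses_epi sg); rewrite -uj !compmA e'.
move=> X x xe; have [|v ev] := ses_desc sg (x := x \oc j).
  by rewrite -compmA -sq compmA xe comp0m.
exists v; apply/eqP; rewrite -subr_eq0; apply/eqP.
have [|w ew] := ses_desc sj (x := (v \oc u) - x).
  by rewrite compmBl -compmA uj ev subrr.
rewrite -ew; suff -> : w = 0 by rewrite comp0m.
apply: (ses_epi s); rewrite -re compmA ew compmBl -compmA ue xe.
by rewrite compm0 subrr comp0m.
Qed.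

Lemma ses_bicartesian M E K E' K' S (b : biproduct E' K S) (i : hom M E)
    (p : hom E K) (i' : hom M E') (p' : hom E' K') f g :
  ses i p -> ses i' p' -> f \oc i = i' -> p' \oc f = g \oc p ->
  ses (pairm b f p) (copairm b p' (- g)).
Proof.
move=> s s' fi pf; have mp : is_mono (pairm b f p).
  apply/mono0P => T t; rewrite pair_comp => e'.
  have ft : f \oc t = 0 by rewrite -(pr1_pair b (f \oc t) (p \oc t)) e' compm0.
  have pt : p \oc t = 0 by rewrite -(pr2_pair b (f \oc t) (p \oc t)) e' compm0.
  have [y ey] := ses_lift s pt.
  have /((mono0P i').1 (ses_mono s')) y0 : i' \oc y = 0.
    by rewrite -fi -compmA ey.
  by rewrite -ey y0 compm0.
apply: kernel_ses.
  move=> X x y e; apply: (ses_epi s').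
  by rewrite -(copair_in1 b p' (- g)) !compmA e.
apply/kernelP; split.
- by rewrite copair_pair compNm pf subrr.
- exact: mp.
move=> X x; rewrite -[x](comp1m x) -(in_pr b) compmDl -!compmA.
rewrite -/(pairm b _ _); move: (pr1 b \oc x) (pr2 b \oc x) => x1 x2.
rewrite copair_pair compNm => /eqP; rewrite subr_eq0 => /eqP e.
(* Lift [x2] to [z] in [E] on a cover. Then [f \oc z] and [x1] differ by an element of [M], and
   subtracting it from [z] gives the required preimage. *)
have [Y [c [z [ec ez]]]] := epi_cover x2 (ses_epi s).
have [|m em] := ses_lift s' (x := (f \oc z) - (x1 \oc c)).
  by rewrite compmBr !compmA pf e -compmA ez compmA subrr.
apply: (mono_lift_cover (y := z - (i \oc m)) mp ec).
rewrite !pair_comp compmBr compmA fi em opprB addrC subrK.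
by rewrite compmBr compmA (ses_comp0 s) comp0m subr0 ez.
Qed.

Lemma split_retract M E K (i : hom M E) (p : hom E K) t : ses i p ->
  p \oc t = idm K -> exists r, r \oc i = idm M.
Proof.
move=> s pt; have [|r er] := ses_lift s (x := idm E - (t \oc p)).
  by rewrite compmBr compmA pt comp1m compm1 subrr.
exists r; apply: (ses_mono s); rewrite compmA er compmBl -compmA (ses_comp0 s).
by rewrite compm0 subr0 comp1m compm1.
Qed.

Lemma split_biproduct M E K (i : hom M E) (p : hom E K) r : ses i p ->
  r \oc i = idm M -> inhabited (biproduct M K E).
Proof.
move=> s ri; have [|t et] := ses_desc s (x := idm E - (i \oc r)).
  by rewrite compmBl -compmA ri comp1m compm1 subrr.
split; apply: (@Biproduct _ _ _ _ i t r p) => //.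
- apply: (ses_epi s); rewrite -compmA et comp0m compmBr compmA ri.
  by rewrite comp1m compm1 subrr.
- exact: ses_comp0 s.
- apply: (ses_epi s); rewrite -compmA et compmBr compmA (ses_comp0 s).
  by rewrite comp0m subr0 compm1 comp1m.
by rewrite et addrC subrK.
Qed.

(** The extension [r] of [i] along [a] is all that injectivity of [Qa] would provide. The middle
    embedding is the pair of [r] and [i' \oc d]. *)
Lemma horseshoe A B D Qa Qd Ka Kd S (b : biproduct Qa Qd S) (a : hom A B)
    (d : hom B D) (i : hom A Qa) (p : hom Qa Ka) (i' : hom D Qd)
    (p' : hom Qd Kd) r :
  ses a d -> ses i p -> ses i' p' -> r \oc a = i ->
  exists K (m : hom B S) (q : hom S K) (x : hom Ka K) (y : hom K Kd),
    ses m q /\ ses x y.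
Proof.
move=> s sa sd ra; pose m := pairm b r (i' \oc d).
have mm : is_mono m.
  apply/mono0P => X x; rewrite pair_comp => e.
  have rx : r \oc x = 0.
    by rewrite -(pr1_pair b (r \oc x) (i' \oc d \oc x)) e compm0.
  have : i' \oc (d \oc x) = 0.
    by rewrite compmA -(pr2_pair b (r \oc x) (i' \oc d \oc x)) e compm0.
  move/((mono0P i').1 (ses_mono sd))/(ses_lift s) => [y ey].
  have /((mono0P i).1 (ses_mono sa)) y0 : i \oc y = 0.
    by rewrite -ra -compmA ey.
  by rewrite -ey y0 compm0.
have [K [q sq]] := mono_ses mm.
have ma : m \oc a = in1 b \oc i.
  apply: (pair_uniq (b := b)).
    by rewrite !compmA pr1_pair pr1in1 comp1m.
  by rewrite !compmA pr2_pair pr2in1 comp0m -compmA (ses_comp0 s) compm0.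
have [|x ex] := ses_desc sa (x := q \oc in1 b).
  by rewrite -compmA -ma compmA (ses_comp0 sq) comp0m.
have [|y ey] := ses_desc sq (x := p' \oc pr2 b).
  by rewrite -compmA pr2_pair compmA (ses_comp0 sd) comp0m.
exists K, m, q, x, y; split=> //; split.
  apply/mono0P => X t xt; have [Y [c [z [ec ez]]]] := epi_cover t (ses_epi sa).
  have [|w ew] := ses_lift sq (x := in1 b \oc z).
    by rewrite compmA -ex -compmA ez compmA xt comp0m.
  have rw : r \oc w = z.
    by rewrite -(pr1_pair b r (i' \oc d)) -compmA ew compmA pr1in1 comp1m.
  have : i' \oc (d \oc w) = 0.
    by rewrite compmA -(pr2_pair b r (i' \oc d)) -compmA ew compmA pr2in1 comp0m.
  move/((mono0P i').1 (ses_mono sd))/(ses_lift s) => [v ev].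
  apply: ec; rewrite comp0m -ez -rw -ev (compmA r) ra compmA (ses_comp0 sa).
  by rewrite comp0m.
apply/cokernelP; split.
- apply: (ses_epi sa); rewrite -compmA ex compmA ey -compmA pr2in1.
  by rewrite compm0 comp0m.
- move=> X t t' e; apply: (ses_epi sd).
  rewrite -(compm1 p') -(pr2in2 b) (compmA p') -ey.
  by rewrite !compmA e.
move=> X t tx.
have t1 : t \oc q \oc in1 b = 0 by rewrite -compmA -ex compmA tx comp0m.
have tq : t \oc q = t \oc q \oc in2 b \oc pr2 b.
  rewrite -{1}(compm1 (t \oc q)) -(in_pr b) compmDr !compmA t1 comp0m.
  by rewrite add0r.
have [|w ew] := ses_desc sd (x := t \oc q \oc in2 b).
  apply: (ses_epi s); rewrite -compmA -(pr2_pair b r (i' \oc d)) compmA -tq.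
  by rewrite -compmA (ses_comp0 sq) compm0 comp0m.
by exists w; apply: (ses_epi sq); rewrite -compmA ey compmA ew -tq.
Qed.

(** The cokernel [M1] of the summand [M] inside [Q] is an extension of [B'] by [N]. Adding [M] turns
    it into an extension of [B'] by [B], which exhibits [M1] as a summand of such an extension. *)
Lemma ses_complement M N B Q B' M1 S (b : biproduct M N B) (i : hom B Q)
    (p : hom Q B') (q : hom Q M1) (b' : biproduct M1 M S) :
  ses i p -> ses (i \oc in1 b) q ->
  exists (n : hom N M1) (r : hom M1 B') (j : hom B S) (t : hom S B'),
    ses n r /\ ses j t.
Proof.
move=> s sq; have [n [r [sn en er]]] := third_iso (ses_biproduct b) s sq.
exists n, r, (pairm b' (n \oc pr2 b) (pr1 b)), (copairm b' r 0); split=> //.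
apply: kernel_ses.
  by move=> X x y e; apply: (ses_epi sn); rewrite -(copair_in1 b' r 0) !compmA e.
apply/kernelP; split.
- by rewrite copair_pair comp0m addr0 compmA (ses_comp0 sn) comp0m.
- move=> X x y; rewrite !pair_comp => e; apply: (pair_uniq (b := b)).
    by have := congr1 (fun z => pr2 b' \oc z) e; rewrite /= !pr2_pair.
  apply: (ses_mono sn); rewrite !compmA.
  by have := congr1 (fun z => pr1 b' \oc z) e; rewrite /= !pr1_pair.
move=> X x; rewrite -[x](comp1m x) -(in_pr b') compmDl -!compmA.
rewrite -/(pairm b' _ _) copair_pair comp0m addr0 => /(ses_lift sn)[u eu].
exists (pairm b (pr2 b' \oc x) u).
by rewrite pair_comp pr1_pair -compmA pr2_pair eu.
Qed.

End ShortExact.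

(** * Long exact sequence of Yoneda Ext *)

Section Chains.
Local Open Scope ring_scope.
Context {C : abelianCat}.
Implicit Types A B D E K M : C.

Record step M := Step {
  step_mid : C; step_end : C;
  step_in : hom M step_mid; step_out : hom step_mid step_end;
  stepP : ses step_in step_out
}.

(* A chain of length k is a string of k short exact sequences starting at M
   with a map from A to the last object; it stands for the k-extension of A
   by M obtained by pulling back along this map. *)
Fixpoint chain A (k : nat) M : Type :=
  if k is k'.+1 then {s : step M & chain A k' (step_end s)} else hom A M.

Definition cchain A k M E K (i : hom M E) (p : hom E K) (s : ses i p)
  (x : chain A k K) : chain A k.+1 M := existT _ (Step s) x.

Lemma cchainP A k M (P : chain A k.+1 M -> Prop) :
  (forall E K (i : hom M E) (p : hom E K) (s : ses i p) (x : chain A k K),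
    P (cchain s x)) -> forall x, P x.
Proof. by move=> H [[E K i p s] x]; apply: H. Qed.

(** Pushforward along [g] is kept as a relation; [push] and [cmor_uniq] make it a function on
    classes. In degree 0 the equation fixes the source [A]. *)
Fixpoint cmor A k M M' : hom M M' -> chain A k M -> chain A k M' -> Prop :=
  match k with
  | 0 => fun g x y => g \oc x = y
  | k'.+1 => fun g x y => exists f h,
      [/\ f \oc step_in (projT1 x) = step_in (projT1 y) \oc g,
          step_out (projT1 y) \oc f = h \oc step_out (projT1 x)
        & @cmor A k' _ _ h (projT2 x) (projT2 y)]
  end.

Definition ceqv A k M : chain A k M -> chain A k M -> Prop :=
  clos_refl_sym_trans (chain A k M) (cmor (idm M)).

Lemma ceqv_refl A k M (x : chain A k M) : ceqv x x.
Proof. exact: rst_refl. Qed.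

Lemma ceqv_sym A k M (x y : chain A k M) : ceqv x y -> ceqv y x.
Proof. exact: rst_sym. Qed.

Lemma ceqv_trans A k M (x y z : chain A k M) :
  ceqv x y -> ceqv y z -> ceqv x z.
Proof. exact: rst_trans. Qed.

Lemma ceqv_mor A k M (x y : chain A k M) : cmor (idm M) x y -> ceqv x y.
Proof. exact: rst_step. Qed.

Lemma ceqv0 A M (x y : chain A 0 M) : ceqv x y <-> x = y.
Proof.
split=> [|->]; last exact: ceqv_refl.
by elim=> [? ? /= <-|//|//|? ? ? _ -> _ ->]; rewrite ?comp1m.
Qed.

Lemma cmor_id A k M (x : chain A k M) : cmor (idm M) x x.
Proof.
elim: k M x => [|k IH] M; first by move=> x /=; rewrite comp1m.
apply: cchainP => E K i p s x /=; exists (idm E), (idm K).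
by rewrite !comp1m !compm1.
Qed.

Lemma cmor_comp A k M M' M'' (g : hom M M') (g' : hom M' M'')
    (x : chain A k M) y z :
  cmor g x y -> cmor g' y z -> cmor (g' \oc g) x z.
Proof.
elim: k M M' M'' g g' x y z => [|k IH] M M' M'' g g' x y z /=.
  by move=> <- <-; rewrite compmA.
move=> [f [h [e1 e2 m]]] [f' [h' [e1' e2' m']]]; exists (f' \oc f), (h' \oc h).
split; last exact: IH m m'.
  by rewrite -compmA e1 compmA e1' compmA.
by rewrite compmA e2' -compmA e2 compmA.
Qed.

Lemma cmor_compl A k M M' (g : hom M M') (x x' : chain A k M) y :
  cmor (idm M) x x' -> cmor g x' y -> cmor g x y.
Proof. by move=> m m'; rewrite -[g]compm1; apply: cmor_comp m m'. Qed.

Lemma cmor_compr A k M M' (g : hom M M') (x : chain A k M) y y' :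
  cmor g x y -> cmor (idm M') y y' -> cmor g x y'.
Proof. by move=> m m'; rewrite -[g]comp1m; apply: cmor_comp m m'. Qed.

(** Push out the first sequence and keep the tail. Any other morphism over [g] factors through the
    pushout, with the identity on [M']. *)
Lemma push_universal A k M M' (g : hom M M') (x : chain A k M) :
  exists y, cmor g x y /\ forall z, cmor g x z -> cmor (idm M') y z.
Proof.
case: k x => [|k] x.
  by exists (g \oc x); split=> //= z <-; rewrite comp1m.
elim/cchainP: x => E K i p s x; have [P [j [e [r [sj ei re univ]]]]] := pushout g s.
exists (cchain sj x); split.
  exists e, (idm K); split=> //=; first by rewrite re comp1m.
  exact: cmor_id.
elim/cchainP=> E' K' i' p' s' y [/= f [h [fi pf m]]].
have [u [ue uj]] := univ _ f i' fi; exists u, h; split=> //=.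
  by rewrite uj compm1.
apply/eqP; rewrite -subr_eq0; apply/eqP.
have [|w ew] := ses_desc sj (x := (p' \oc u) - (h \oc r)).
  by rewrite compmBl -!compmA uj (ses_comp0 s') (ses_comp0 sj) compm0 subrr.
rewrite -ew; suff -> : w = 0 by rewrite comp0m.
apply: (ses_epi s).
by rewrite -re compmA ew compmBl -!compmA ue re pf subrr comp0m.
Qed.

Lemma push A k M M' (g : hom M M') (x : chain A k M) : exists y, cmor g x y.
Proof. by have [y []] := push_universal g x; exists y. Qed.

Lemma cmor_uniq A k M M' (g : hom M M') (x : chain A k M) y y' :
  cmor g x y -> cmor g x y' -> ceqv y y'.
Proof.
move=> m m'; have [z [_ univ]] := push_universal g x.
by apply: ceqv_trans (ceqv_mor (univ _ m')); apply/ceqv_sym/ceqv_mor/univ.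
Qed.

Lemma cmor_ceqv A k M M' (g : hom M M') (x x' : chain A k M) y y' :
  ceqv x x' -> cmor g x y -> cmor g x' y' -> ceqv y y'.
Proof.
move=> e; elim: e y y' => {x x'} [x x' m|x|x x' _ IH|x x' x'' _ IH _ IH'] y y'.
- by move=> my my'; apply: cmor_uniq my (cmor_compl m my').
- exact: cmor_uniq.
- by move=> my my'; apply/ceqv_sym/IH.
have [z mz] := push g x' => my my'.
by apply: ceqv_trans (IH _ _ my mz) (IH' _ _ mz my').
Qed.

Lemma cchain_ceqv A k M E K (i : hom M E) (p : hom E K) (s : ses i p)
    (x y : chain A k K) : ceqv x y -> ceqv (cchain s x) (cchain s y).
Proof.
elim=> {x y} [x y m|x|x y _ IH|x y z _ IH _ IH'].
- apply: ceqv_mor; exists (idm E), (idm K).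
  by rewrite /= !compm1 !comp1m.
- exact: ceqv_refl.
- exact: ceqv_sym.
exact: ceqv_trans IH IH'.
Qed.

(** Termwise sums of the sequences, with the map from [A] paired at the end. This makes classes over
    a biproduct pairs of classes and takes the place of addition on Ext. *)
Lemma chain_pair A k X Y S (b : biproduct X Y S) (x : chain A k X)
    (y : chain A k Y) :
  exists z : chain A k S, [/\ cmor (pr1 b) z x, cmor (pr2 b) z y
    & forall W (w : chain A k W) g h,
      cmor g w x -> cmor h w y -> cmor (pairm b g h) w z].
Proof.
elim: k X Y S b x y => [|k IH] X Y S b x y.
  exists (pairm b x y); split; [exact: pr1_pair|exact: pr2_pair|].
  by move=> W w g h /= <- <-; rewrite pair_comp.
elim/cchainP: x => E K i p s x; elim/cchainP: y => E' K' i' p' s' y.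
pose bE := bsumb E E'; pose bK := bsumb K K'.
have [z [zx zy zu]] := IH _ _ _ bK x y.
exists (cchain (ses_prod b bE bK s s') z); split.
- by exists (pr1 bE), (pr1 bK); split; rewrite //= pr1_pair.
- by exists (pr2 bE), (pr2 bK); split; rewrite //= pr2_pair.
move=> W; elim/cchainP=> E1 K1 i1 p1 s1 w g h [/= f [f' [e1 e2 m]]].
move=> [/= l [l' [e1' e2' m']]]; exists (pairm bE f l), (pairm bK f' l').
split; rewrite /= ?pair_comp; last exact: zu.
  by rewrite -!compmA pr1_pair pr2_pair e1 e1'.
by rewrite -!compmA pr1_pair pr2_pair e2 e2'.
Qed.

(** A class over a biproduct is determined by its projections: chains with the same projections both
    map to the universal pair, and the equivalence of first components is handled generator by
    generator. *)
Lemma chain_pair_ceqv A k X Y S (b : biproduct X Y S) (x x' : chain A k X)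
    (y : chain A k Y) (z z' : chain A k S) : ceqv x x' ->
  cmor (pr1 b) z x -> cmor (pr2 b) z y ->
  cmor (pr1 b) z' x' -> cmor (pr2 b) z' y -> ceqv z z'.
Proof.
have id_pair : pairm b (pr1 b) (pr2 b) = idm S by rewrite -(in_pr b).
have base w w' o : cmor (pr1 b) w o -> cmor (pr2 b) w y ->
    cmor (pr1 b) w' o -> cmor (pr2 b) w' y -> ceqv w w'.
  move=> m1 m2 m1' m2'; have [u [_ _ univ]] := chain_pair b o y.
  apply: (ceqv_trans (y := u)).
    by apply: ceqv_mor; rewrite -id_pair; apply: univ.
  by apply/ceqv_sym/ceqv_mor; rewrite -id_pair; apply: univ.
move=> e; elim: e z z' => {x x'} [x x' m|x|x x' _ IH|x x' x'' _ IH _ IH'] z z'.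
- by move=> m1 m2; apply: base m2; apply: cmor_compr m1 m.
- exact: base.
- by move=> m1 m2 m1' m2'; apply/ceqv_sym/IH.
have [u [u1 u2 _]] := chain_pair b x' y.
move=> m1 m2 m1' m2'.
by apply: ceqv_trans (IH _ _ m1 m2 u1 u2) (IH' _ _ u1 u2 m1' m2').
Qed.

(* The vanishing criterion read off the long exact sequence of the first short
   exact sequence of the chain. *)
Definition czero A k M : chain A k M -> Prop :=
  match k with
  | 0 => fun x => x = 0
  | k'.+1 => fun x => exists r y,
      cmor (step_out (projT1 x)) r y /\ ceqv y (projT2 x)
  end.

(** Over the zero map, the middle component kills [i] and so factors through [K]. Pushing the tail
    along this factor gives the lift demanded by [czero]. *)
Lemma czero_cmor0 A k M M' (x : chain A k M) y :
  cmor (0 : hom M M') x y -> czero y.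
Proof.
case: k x y => [|k] x y /=; first by rewrite comp0m.
elim/cchainP: x => E K i p s x; elim/cchainP: y => E' K' i' p' s' y /=.
move=> [f [h [fi pf m]]].
have [|e ee] := ses_desc s (x := f); first by rewrite fi compm0.
have eh : p' \oc e = h by apply: (ses_epi s); rewrite -compmA ee.
have [r mr] := push e x; have [z mz] := push p' r.
exists r, z; split=> //; apply: cmor_uniq m.
by rewrite -eh; apply: cmor_comp mr mz.
Qed.

Definition middle_exact A k := forall M B D (i : hom M B) (p : hom B D)
  (x : chain A k B) y, ses i p -> cmor p x y -> czero y ->
  exists r z, cmor i r z /\ ceqv z x.

Definition czero_invariant A k := forall M (x y : chain A k M),
  ceqv x y -> czero x -> czero y.

(** In positive degree, divide the middle term [E] by [M]: the pushforward of the chain along [p]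
    may be taken to start with [D -> E1 -> K]. A lift of its tail to [E1], spliced with
    [M -> E -> E1], is the required preimage. *)
Lemma middle_exactS A k : czero_invariant A k -> middle_exact A k.
Proof.
case: k => [|k] inv M B D i p x y s.
  move=> /= <- /(ses_lift s)[u eu]; exists u, x; split=> //.
  exact: ceqv_refl.
elim/cchainP: x => E K j q sj x m zy.
have [|E1 [e se]] := @mono_ses _ _ _ (j \oc i).
  exact: mono_comp (ses_mono sj) (ses_mono s).
have [c [r [sc ec er]]] := third_iso s sj se.
have : czero (cchain sc x).
  apply: inv zy; apply: cmor_uniq m _; exists e, (idm K); split=> //=.
    by rewrite er comp1m.
  exact: cmor_id.
move=> [/= u [v [m' ev]]]; exists (cchain se u), (cchain sj v); split.
  by exists (idm E), r; rewrite /= comp1m compm1 er.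
exact: cchain_ceqv.
Qed.

Lemma czero_ceqv A k : czero_invariant A k.
Proof.
elim: k => [|k IH]; first by move=> M x y /ceqv0 ->.
have ME := middle_exactS IH.
suff H M (x y : chain A k.+1 M) : cmor (idm M) x y -> czero x <-> czero y.
  move=> M x y; suff : ceqv x y -> czero x <-> czero y by move=> h /h [].
  elim=> {x y} [x y /H //|//|x y _ IHx|x y z _ IHx _ IHy].
    by split=> /IHx.
  by split=> [/IHx/IHy|/IHy/IHx].
elim/cchainP: x => E K i p s x; elim/cchainP: y => E' K' i' p' s' y /=.
move=> [f [g [fi pf m]]]; rewrite compm1 in fi; split.
  (* Forward direction: push the lift along the middle component [f]. *)
  move=> [u [v [mu ev]]]; have [w mw] := push f u; have [z mz] := push p' w.
  exists w, z; split=> //; have [t mt] := push g v.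
  apply: (ceqv_trans (y := t)); last exact: cmor_ceqv ev mt m.
  apply: (@cmor_uniq _ _ _ _ (g \oc p) u); last exact: cmor_comp mu mt.
  by rewrite -pf; apply: cmor_comp mw mz.
(* From g_* x = p'_* r one gets an element (r, x) of Ext^k(A, E' + K) which
   vanishes in Ext^k(A, K'), hence comes from Ext^k(A, E). *)
move=> [r [v [mr ev]]].
pose b := bsumb E' K; pose d := bsumb K' K'.
have [z [zr zx _]] := chain_pair b r x.
have [t [t1 t2 tu]] := chain_pair d y y.
have [t' [t1' t2' tu']] := chain_pair d v y.
have [w mw] := push (copairm d (idm K') (- idm K')) t'.
have [w0 mw0] := push (copairm d (idm K') (- idm K')) t.
(* The pair of [y] with itself is the image of [y] under the diagonal, which the difference map
   kills. *)
have zw0 : czero w0.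
  apply: (@czero_cmor0 _ _ K' _ y).
  have -> : 0 = copairm d (idm K') (- idm K') \oc pairm d (idm K') (idm K').
    by rewrite copair_pair compNm subrr.
  by apply: cmor_comp mw0; apply: tu; apply: cmor_id.
(* Since [v] and [y] are equivalent, so are the two differences; invariance one degree lower
   transfers the vanishing. *)
have zw : czero w.
  apply: IH zw0; apply: cmor_ceqv mw0 mw.
  by apply: (chain_pair_ceqv (b := d)) t1 t2 t1' t2'; apply: ceqv_sym.
have mz : cmor (copairm b p' (- g)) z w.
  have -> : copairm b p' (- g) = copairm d (idm K') (- idm K')
              \oc pairm d (p' \oc pr1 b) (g \oc pr2 b).
    by rewrite copair_pair !comp1m compNm comp1m /copairm !compNm.
  by apply: cmor_comp mw; apply: tu'; [apply: cmor_comp zr mr|apply: cmor_comp zx m].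
have [u [z' [mu ez]]] := ME _ _ _ _ _ _ _ (ses_bicartesian b s s' fi pf) mz zw.
have [q mq] := push (pr2 b) z'.
exists u, q; split; last exact: cmor_ceqv ez mq zx.
by rewrite /= -(pr2_pair b f p); apply: cmor_comp mu mq.
Qed.

Lemma middle_exact_chain A k : middle_exact A k.
Proof. exact/middle_exactS/czero_ceqv. Qed.

Lemma czero_push A k M M' (g : hom M M') (x : chain A k M) y :
  czero x -> cmor g x y -> czero y.
Proof.
case: k x y => [|k] x y; first by move=> /= -> <-; rewrite compm0.
elim/cchainP: x => E K i p s x; elim/cchainP: y => E' K' i' p' s' y /=.
move=> [r [z [mr ez]]] [f [h [fi pf m]]].
have [r' mr'] := push f r; have [z' mz'] := push p' r'.
exists r', z'; split=> //; have [t mt] := push h z.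
apply: (ceqv_trans (y := t)); last exact: cmor_ceqv ez mt m.
apply: (@cmor_uniq _ _ _ _ (h \oc p) r); last exact: cmor_comp mr mt.
by rewrite -pf; apply: cmor_comp mr' mz'.
Qed.

(** Any chain over a zero object will do, pushed to [M] along 0. *)
Lemma exists_czero A k M : exists x : chain A k M, czero x.
Proof.
have [y _] : exists y : chain A k zobj, True.
  elim: k => [|k [y _]]; first by exists 0.
  by exists (cchain (ses_id zobj zobjP) y).
by have [x m] := push (0 : hom zobj M) y; exists x; apply: czero_cmor0 m.
Qed.

Lemma czero_uniq A k M (x y : chain A k M) : czero x -> czero y -> ceqv x y.
Proof.
elim: k M x y => [|k IH] M x y; first by move=> /= -> ->; apply: ceqv_refl.
(* The identity of a zero object is 0, so all chains over it vanish and the induction hypothesis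
   identifies them. *)
have all0 (u v : chain A k zobj) : ceqv u v.
  have cz (w : chain A k zobj) : czero w.
    by apply: (@czero_cmor0 _ _ zobj _ w); rewrite -((zeroP zobj).1 zobjP);
       apply: cmor_id.
  exact: IH.
suff H (w : chain A k zobj) (z : chain A k.+1 M) : czero z ->
    ceqv z (cchain (ses_id M zobjP) w).
  have [w _] := exists_czero A k zobj => /(H w) e /(H w) e'.
  by apply: ceqv_trans e _; apply: ceqv_sym.
elim/cchainP: z => E K i p s z [/= r [t [mr et]]].
apply: ceqv_trans (cchain_ceqv s (ceqv_sym et)) _.
(* The tail is now the image of its lift [r] to [E]. The map [(i, id)] from the split sequence to
   the given one allows [r] itself as tail. *)
pose b := bsumb M E; apply: (ceqv_trans (y := cchain (ses_biproduct b) r)).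
  apply/ceqv_sym/ceqv_mor; exists (copairm b i (idm E)), p; split=> //=.
    by rewrite copair_in1 compm1.
  by rewrite copair_comp (ses_comp0 s) compm1 /copairm comp0m add0r.
(* Projection to [M] replaces the split sequence by [M -> M -> 0], where the tail is immaterial by
   [all0]. *)
have [w' mw] := push (0 : hom E zobj) r.
apply: ceqv_trans (cchain_ceqv _ (all0 w' w)).
apply: ceqv_mor; exists (pr1 b), 0; split=> //=.
  by rewrite pr1in1 comp1m.
by rewrite !comp0m.
Qed.

Definition ext_trivial A k M := forall x : chain A k M, czero x.

Lemma ext_trivialP A k M : ext_trivial A k M <-> forall x y : chain A k M, ceqv x y.
Proof.
split=> [H x y|H x]; first exact: czero_uniq.
by have [z cz] := exists_czero A k M; apply: czero_ceqv (H z x) cz.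
Qed.

Section LongExact.
Context {A M E K : C} {i : hom M E} {p : hom E K} (s : ses i p) (k : nat).

Lemma ext_trivial_mid : ext_trivial A k M -> ext_trivial A k K ->
  ext_trivial A k E.
Proof.
move=> tM tK x; have [y m] := push p x.
have [r [z [mr ez]]] := middle_exact_chain s m (tK y).
by apply: czero_ceqv ez _; apply: czero_push mr.
Qed.

(** Pushing the first sequence of the chain out along [i] gives [P], with both [E -> P -> L] and
    [D -> P -> K] exact. Vanishing over [E] lifts the tail to [P]; vanishing over [K] then lifts it
    further to [D]. *)
Lemma ext_trivial_left : ext_trivial A k K -> ext_trivial A k.+1 E ->
  ext_trivial A k.+1 M.
Proof.
move=> tK tE; elim/cchainP=> D L j q sj x.
have [P [j' [e [r [u [sj' su sq re uj]]]]]] := pushout_mono sj s.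
have [y [z [/= my ez]]] := tE (cchain sj' x).
have [t mt] := push u y.
have [v [w [mv ew]]] := middle_exact_chain su mt (tK t).
have [v' mv'] := push q v; exists v, v'; split=> //.
apply: ceqv_trans ez; have [w' mw'] := push r w.
apply: ceqv_trans (cmor_ceqv ew mw' my); apply: (cmor_uniq mv').
by rewrite -re; apply: cmor_comp mv mw'.
Qed.

(** Splice the chain with [s]: vanishing of the result says precisely that the chain comes from
    [E]. *)
Lemma ext_trivial_right : ext_trivial A k E -> ext_trivial A k.+1 M ->
  ext_trivial A k K.
Proof.
move=> tE tM x; have [y [z [/= my ez]]] := tM (cchain s x).
by apply: czero_ceqv ez _; apply: czero_push my.
Qed.

End LongExact.

Lemma ext_trivial_split A k M N S (b : biproduct M N S) :
  ext_trivial A k S -> ext_trivial A k M.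
Proof.
move=> tS x; have [y my] := push (in1 b) x; have [z mz] := push (pr1 b) y.
have m : cmor (idm M) x z by rewrite -(pr1in1 b); apply: cmor_comp my mz.
by apply: (czero_ceqv (ceqv_sym (ceqv_mor m))); apply: czero_push mz.
Qed.

(** For the chain formed by the sequence and the identity of [A], the lift demanded by [czero] is a
    section of [p]. *)
Lemma ext1_split A M E (i : hom M E) (p : hom E A) : ext_trivial A 1 M ->
  ses i p -> exists r, r \oc i = idm M.
Proof.
move=> t s; have [r [y [/= e /ceqv0 ey]]] := t (cchain s (idm A : chain A 0 A)).
by apply: (split_retract s (t := r)); rewrite e.
Qed.

(** The pushout along [g] splits, and its retraction gives the extension. *)
Lemma ext1_extend A M E K (i : hom K E) (p : hom E A) (g : hom K M) :
  ext_trivial A 1 M -> ses i p -> exists f, f \oc i = g.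
Proof.
move=> t s; have [P [j [e [r [sj sq re _]]]]] := pushout g s.
have [l lj] := ext1_split t sj.
by exists (l \oc e); rewrite -compmA sq compmA lj comp1m.
Qed.

End Chains.

(** * Chains and extensions *)

Section Exact.
Local Open Scope ring_scope.
Context {C : abelianCat}.
Implicit Types A B D E K M : C.

Lemma cokernel_epi A B D Q (m : hom B D) (e : hom A B) (q : hom D Q) :
  is_epi e -> is_cokernel (m \oc e) q <-> is_cokernel m q.
Proof.
move=> ee; split=> /cokernelP[qe eq cq]; apply/cokernelP; split=> //.
- by apply: ee; rewrite -compmA qe comp0m.
- by move=> X x xm; apply: cq; rewrite compmA xm comp0m.
- by rewrite compmA qe comp0m.
by move=> X x xm; apply: cq; apply: ee; rewrite -compmA xm comp0m.
Qed.

Lemma epi_mono_image A B D (m : hom B D) (e : hom A B) :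
  is_epi e -> is_mono m -> is_image (m \oc e) m.
Proof.
move=> ee mm; have [Q [q cq]] := has_cokernels m.
by exists Q, q; split; [apply/cokernel_epi | apply: mono_kernel].
Qed.

Lemma epi_mono_exact A B D F (m : hom B D) (e : hom A B) (g : hom D F) :
  is_epi e -> is_mono m -> is_exact (m \oc e) g <-> is_kernel g m.
Proof.
move=> ee mm; split; last first.
  by move=> gm; exists B, m; split=> //; apply: epi_mono_image.
move=> [I [i [[Q [q [cq /kernelP[qi mi ki]]]] /kernelP[gi _ kg]]]].
have {}cq := (cokernel_epi m q ee).1 cq.
have /kernelP[qm _ km] := mono_kernel mm cq.
apply/kernelP; split=> //; first have [u <-] := ki _ _ qm.
  by rewrite compmA gi comp0m.
by move=> X x /kg[u <-]; apply: km; rewrite compmA qi comp0m.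
Qed.

Lemma mono_exact B D F (m : hom B D) (g : hom D F) :
  is_mono m -> is_exact m g <-> is_kernel g m.
Proof.
by move=> mm; rewrite -{1}[m]compm1; apply: epi_mono_exact => //; apply: epi_id.
Qed.

Lemma mono_comp_kernel M E K L (i : hom M E) (p : hom E K) (m : hom K L) :
  is_mono m -> is_kernel p i -> is_kernel (m \oc p) i.
Proof.
move=> mm /kernelP[pi mi ki]; apply/kernelP; split=> //.
  by rewrite -compmA pi compm0.
by move=> X x; rewrite -compmA -{1}(compm0 X m) => /mm; apply: ki.
Qed.

Lemma zero_exact A B D (f : hom A B) (g : hom B D) : is_zero B -> is_exact f g.
Proof.
move=> zB; exists B, (idm B); split; last first.
  apply/kernelP; split; [exact: zero_from|exact: mono_id|].
  by move=> X x _; exists x; apply: comp1m.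
exists B, (idm B); split.
  apply/cokernelP; split; [exact: zero_to|exact: epi_id|].
  by move=> X x _; exists x; apply: compm1.
apply/kernelP; split; [exact: zero_to|exact: mono_id|].
by move=> X x _; exists x; apply: comp1m.
Qed.

Lemma short_exactP M E K (i : hom M E) (p : hom E K) :
  short_exact i p <-> ses i p.
Proof.
split=> [[mi ex ep]|s].
  by apply: kernel_ses => //; apply/mono_exact.
split; [exact: ses_mono s| |exact: ses_epi s].
by apply/mono_exact; [exact: ses_mono s|exact: ses_ker].
Qed.

Lemma image_uniq A B D (f : hom A B) (m : hom D B) I (i : hom I B) :
  is_image f i -> is_image f m -> exists u : hom D I, isom u.
Proof.
move=> [Q [q [/cokernelP[qf _ cq] /kernelP[qi mi ki]]]].
move=> [Q' [q' [/cokernelP[qf' _ cq'] /kernelP[qm mm km]]]].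
have [v ev] := cq' _ _ qf; have [v' ev'] := cq _ _ qf'.
have [|u eu] := ki _ m; first by rewrite -ev -compmA qm compm0.
have [|u' eu'] := km _ i; first by rewrite -ev' -compmA qi compm0.
exists u, u'; split; first by apply: mm; rewrite compmA eu' eu compm1.
by apply: mi; rewrite compmA eu eu' compm1.
Qed.

Definition cos_single M : cosequence M :=
  @Cosequence C M (fun n => if n is 0 then M else zobj) (idm M) (fun n => 0).

Definition cos_cons M E K (i : hom M E) (p : hom E K) (t : cosequence K) :
  cosequence M :=
  @Cosequence C M (fun n => if n is n'.+1 then cterm t n' else E) i
    (fun n => match n as m return hom
         (if m is m'.+1 then cterm t m' else E) (cterm t m) with
       | 0 => caug t \oc p
       | n'.+1 => cdiff t n'
       end).

Definition cos_shift M (s : cosequence M) K (j : hom K (cterm s 1)) :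
  cosequence K :=
  @Cosequence C K (fun n => cterm s n.+1) j (fun n => cdiff s n.+1).

Lemma exact_single M : exact_cosequence (cos_single M).
Proof.
split; first exact: mono_id.
  apply/mono_exact; first exact: mono_id.
  exact: ses_ker (ses_id M zobjP).
by move=> i; apply: zero_exact; apply: zobjP.
Qed.

Lemma ends_single M : ends_at 0 (cos_single M).
Proof. by case=> // i _; apply: zobjP. Qed.

Lemma exact_cons M E K (i : hom M E) (p : hom E K) (t : cosequence K) :
  ses i p -> exact_cosequence t -> exact_cosequence (cos_cons i p t).
Proof.
move=> s [mt et e]; split; first exact: ses_mono s.
  apply/mono_exact; first exact: ses_mono s.
  exact: mono_comp_kernel mt (ses_ker s).
case=> [|n] /=; last exact: e.
by apply/epi_mono_exact; [exact: ses_epi s| |apply/mono_exact].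
Qed.

Lemma ends_cons M E K (i : hom M E) (p : hom E K) (t : cosequence K) n :
  ends_at n t -> ends_at n.+1 (cos_cons i p t).
Proof. by move=> e [|k] //; apply: e. Qed.

(** Cut at the cokernel [K] of the augmentation: the first differential factors through it, and the
    factor is mono because the kernel of that differential is [M]. *)
Lemma exact_uncons M (s : cosequence M) : exact_cosequence s ->
  exists K (p : hom (cterm s 0) K) (j : hom K (cterm s 1)),
    [/\ ses (caug s) p, j \oc p = cdiff s 0, is_mono j
      & exact_cosequence (cos_shift j)].
Proof.
move=> [ms e0 e]; have [K [p sp]] := mono_ses ms.
have /(mono_exact _ ms)/kernelP[d0 _ kd] := e0.
have [j ej] := ses_desc sp d0.
have mj : is_mono j.
  apply/mono0P => X x jx; have [Y [c [y [ec ey]]]] := epi_cover x (ses_epi sp).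
  have [|z ez] := kd _ y; first by rewrite -ej -compmA ey compmA jx comp0m.
  by apply: ec; rewrite comp0m -ey -ez compmA (ses_comp0 sp) comp0m.
exists K, p, j; split=> //; split=> //; last by move=> i; apply: (e i.+1).
apply/(mono_exact _ mj)/(epi_mono_exact _ (ses_epi sp) mj).
by rewrite ej; apply: (e 0%N).
Qed.

Lemma exact_single_isom M (s : cosequence M) :
  exact_cosequence s -> ends_at 0 s -> isom (caug s).
Proof.
move=> es e0; have [K [p [j [sp ej mj _]]]] := exact_uncons es.
apply: mono_epi_isom; first exact: ses_mono sp.
have z1 : is_zero (cterm s 1) by apply: e0.
have zK : is_zero K.
  by apply/zeroP; apply: mj; rewrite (zero_to (j \oc idm K)) // compm0.
apply/epi0P => X x xs; have [u <-] := ses_desc sp xs.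
by rewrite (zero_from u zK) comp0m.
Qed.

(** The component in position [k] is recorded so that it can be compared with the end maps to or
    from [A]. *)
Definition cos_mor k M M' (g : hom M M') (s : cosequence M) (t : cosequence M')
    (a : hom (cterm s k) (cterm t k)) : Prop :=
  exists h : forall i, hom (cterm s i) (cterm t i),
    [/\ h 0%N \oc caug s = caug t \oc g,
        forall i, h i.+1 \oc cdiff s i = cdiff t i \oc h i & h k = a].

Lemma cos_mor_comp k M M' M'' (g : hom M M') (g' : hom M' M'') s t u a b :
  @cos_mor k _ _ g s t a -> @cos_mor k _ _ g' t u b ->
  @cos_mor k _ _ (g' \oc g) s u (b \oc a).
Proof.
move=> [h [h0 hd <-]] [h' [h0' hd' <-]]; exists (fun i => h' i \oc h i); split=> //.
  by rewrite -compmA h0 compmA h0' compmA.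
by move=> i; rewrite -compmA hd compmA hd' compmA.
Qed.

Lemma cos_mor_single M M' (g : hom M M') (s : cosequence M) (a : hom _ M') :
  a \oc caug s = g -> @cos_mor 0 _ _ g s (cos_single M') a.
Proof.
move=> e; exists (fun i => match i as n return
    hom (cterm s n) (cterm (cos_single M') n) with 0 => a | n.+1 => 0 end).
by split=> [|i|] //=; rewrite ?comp1m ?comp0m.
Qed.

Lemma cos_mor_cons k M M' E' K' (g : hom M M') (s : cosequence M) K p
    (j : hom K (cterm s 1)) f h (i' : hom M' E') (p' : hom E' K')
    (t : cosequence K') a :
  j \oc p = cdiff s 0 -> f \oc caug s = i' \oc g -> p' \oc f = h \oc p ->
  @cos_mor k _ _ h (cos_shift j) t a -> @cos_mor k.+1 _ _ g s (cos_cons i' p' t) a.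
Proof.
move=> ej ef eh [l [l0 ld <-]].
exists (fun i => match i as n return
    hom (cterm s n) (cterm (cos_cons i' p' t) n) with 0 => f | n.+1 => l n end).
split=> // -[|i] /=; last exact: ld.
by rewrite -ej compmA l0 -!compmA eh.
Qed.

Lemma cos_mor_cons_cons k M M' E E' K K' (g : hom M M') (i : hom M E)
    (p : hom E K) (s : cosequence K) f h (i' : hom M' E') (p' : hom E' K')
    (t : cosequence K') a :
  f \oc i = i' \oc g -> p' \oc f = h \oc p ->
  @cos_mor k _ _ h s t a ->
  @cos_mor k.+1 _ _ g (cos_cons i p s) (cos_cons i' p' t) a.
Proof.
move=> ef eh m; apply: (@cos_mor_cons _ _ _ _ _ _ (cos_cons i p s) _ p (caug s)
  f h) => //.
Qed.

Lemma cos_mor_uncons k M M' E' K' (g : hom M M') (s : cosequence M) K p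
    (j : hom K (cterm s 1)) (i' : hom M' E') (p' : hom E' K')
    (t : cosequence K') a :
  ses (caug s) p -> p' \oc i' = 0 -> j \oc p = cdiff s 0 ->
  @cos_mor k.+1 _ _ g s (cos_cons i' p' t) a ->
  exists f h, [/\ f \oc caug s = i' \oc g, p' \oc f = h \oc p
    & @cos_mor k _ _ h (cos_shift j) t a].
Proof.
move=> sp pi ej [l [l0 ld la]].
have [|h eh] := ses_desc sp (x := p' \oc l 0%N).
  by rewrite -compmA l0 compmA pi comp0m.
exists (l 0%N), h; split=> //; exists (fun i => l i.+1); split=> //=.
  apply: (ses_epi sp); rewrite -compmA ej ld /=.
  by rewrite -!compmA eh.
Qed.

End Exact.

(** * Correspondence between chains and Yoneda extensions *)

Section ExtChain.
Local Open Scope ring_scope.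
Context {C : abelianCat} {A : C}.
Implicit Types E K M : C.

Fixpoint chain_cos k M : chain A k M -> cosequence M :=
  match k with
  | 0 => fun=> cos_single M
  | k'.+1 => fun x => cos_cons (step_in (projT1 x)) (step_out (projT1 x))
                        (@chain_cos k' _ (projT2 x))
  end.

Fixpoint chain_tail k M : forall x : chain A k M, hom A (cterm (chain_cos x) k) :=
  match k with
  | 0 => fun x => x
  | k'.+1 => fun x => @chain_tail k' _ (projT2 x)
  end.

Lemma cmor_cos k M M' (g : hom M M') (x : chain A k M) (y : chain A k M') :
  cmor g x y -> exists a, cos_mor (k := k) g (s := chain_cos x)
    (t := chain_cos y) a /\ a \oc chain_tail x = chain_tail y.
Proof.
elim: k M M' g x y => [|k IH] M M' g x y.
  by move=> e; exists g; split=> //; apply: cos_mor_single; rewrite compm1.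
move=> [f [h [fi pf /IH[a [m ea]]]]]; exists a; split=> //.
exact: cos_mor_cons_cons fi pf m.
Qed.

(** When [e] is invertible and [g] is an identity, this says that [x] represents the class of the
    extension: the component in position [k] has to be the end map followed by the tail. *)
Definition realizes k M M' (g : hom M M') (s : cosequence M)
    (e : hom (cterm s k) A) (x : chain A k M') : Prop :=
  cos_mor (k := k) g (s := s) (t := chain_cos x) (chain_tail x \oc e).

Lemma realizes_cmor k M M' M'' (g : hom M M') (g' : hom M' M'') s e
    (x : chain A k M') (y : chain A k M'') :
  realizes g (s := s) e x -> cmor g' x y -> realizes (g' \oc g) (s := s) e y.
Proof.
move=> r /cmor_cos[a [m ea]]; rewrite /realizes -ea -compmA.
exact: cos_mor_comp r m.
Qed.

(** Cutting [s] into short exact sequences and inverting the end map gives a chain that maps to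
    every chain realized by [s]. A general [g] is needed for the induction to pass to cokernels. *)
Lemma exists_realized k M (s : cosequence M) (e : hom (cterm s k) A) :
  exact_cosequence s -> ends_at k s -> isom e ->
  exists c : chain A k M, realizes (idm M) (s := s) e c /\
    forall M' (g : hom M M') x, realizes g (s := s) e x -> cmor g c x.
Proof.
elim: k M s e => [|k IH] M s e es ek [e' [e'e ee']].
  have [c [cs sc]] := exact_single_isom es ek.
  exists (c \oc e'); split.
    rewrite /realizes /= -compmA e'e compm1; exact: cos_mor_single.
  move=> M' g x [h [/= h0 _ h1]]; rewrite comp1m in h0.
  by rewrite -h0 h1 compmA -(compmA _ (caug s)) sc compm1 -compmA ee' compm1.
have [K [p [j [sp ej mj es']]]] := exact_uncons es.
have [||c [rc uc]] := IH _ (cos_shift j) e es'.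
- by move=> i; apply: (ek i.+1).
- by exists e'.
exists (cchain sp c); split.
  apply: (cos_mor_cons (f := idm _) (h := idm _) ej) rc.
    by rewrite comp1m compm1.
  by rewrite comp1m compm1.
move=> M' g x; elim/(@cchainP C A): x => E' K' i' p' s' x.
move=> /(cos_mor_uncons sp (ses_comp0 s') ej)[f [h [ef eh m]]].
by exists f, h; split=> //; apply: uc.
Qed.

(** Pulling the last sequence back along the tail yields an extension ending in [A], weakly terminal
    among those realizing [y]. The degree is positive because there must be a sequence to pull
    back. *)
Lemma universal_realizer k M (y : chain A k.+1 M) :
  exists (t : cosequence M) (e : hom (cterm t k.+1) A),
  [/\ exact_cosequence t, ends_at k.+1 t, isom e,
      realizes (idm M) (s := t) e y
    & forall M' (g : hom M' M) s (e' : hom (cterm s k.+1) A),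
      exact_cosequence s -> realizes g (s := s) e' y ->
      exists a, cos_mor (k := k.+1) g (s := s) (t := t) a /\ e \oc a = e'].
Proof.
elim: k M y => [|k IH] M y; elim/(@cchainP C A): y => E K i p sp y.
  have [P [j [l [r [sj lj pl univ]]]]] := pullback y sp.
  exists (cos_cons j r (cos_single A)), (idm A); split.
  - exact: exact_cons sj (exact_single A).
  - exact: ends_cons (ends_single A).
  - exact: isom_id.
  - rewrite /realizes /= compm1.
    apply: (cos_mor_cons_cons (f := l) (h := y)) => //.
      by rewrite lj compm1.
    by apply: cos_mor_single; rewrite compm1.
  move=> M' g s e es r'; have [K1 [p1 [j1 [sp1 ej1 _ _]]]] := exact_uncons es.
  have [f [h [ef eh [h' [/= h0 _ h1]]]]] := cos_mor_uncons sp1 (ses_comp0 sp) ej1 r'.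
  rewrite comp1m in h0.
  have [|u [lu ru]] := univ _ f (e \oc j1 \oc p1).
    by rewrite eh -h0 h1 !compmA.
  exists e; split; last by rewrite comp1m.
  apply: (cos_mor_cons (f := u) (h := e \oc j1) ej1) => //; last first.
    exact: cos_mor_single.
  (* The two maps into the pullback agree after [r], so their difference comes from [M], where it
     vanishes because they also agree in [E]. *)
  apply/eqP; rewrite -subr_eq0; apply/eqP.
  have [|w ew] := ses_lift sj (x := (u \oc caug s) - (j \oc g)).
    rewrite compmBr !compmA ru (ses_comp0 sj) comp0m subr0.
    by rewrite -compmA (ses_comp0 sp1) compm0.
  suff w0 : w = 0 by rewrite -ew w0 compm0.
  apply: (ses_mono sp).
  by rewrite -lj -compmA ew compmBr !compmA lu lj ef subrr compm0.
have [t [e [et en ie rt univ]]] := IH _ y.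
exists (cos_cons i p t), e; split=> //.
- exact: exact_cons.
- exact: ends_cons.
- apply: (cos_mor_cons_cons (f := idm _) (h := idm _)) rt.
    by rewrite comp1m compm1.
  by rewrite comp1m compm1.
move=> M' g s e' es r'; have [K1 [p1 [j1 [sp1 ej1 _ es1]]]] := exact_uncons es.
have [f [h [ef eh m]]] := cos_mor_uncons sp1 (ses_comp0 sp) ej1 r'.
have [a [ma ea]] := univ _ _ _ _ es1 m.
by exists a; split=> //; apply: cos_mor_cons ej1 ef eh ma.
Qed.

Definition ext_realizes k M (s : extension k A M) (x : chain A k M) : Prop :=
  realizes (idm M) (s := ext_seq s) (ext_end s) x.

Lemma ext_morphismP k M (s t : extension k A M) : extension_morphism s t <->
  exists a, cos_mor (k := k) (idm M) (s := ext_seq s) (t := ext_seq t) a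
    /\ ext_end t \oc a = ext_end s.
Proof.
split=> [[h [h0 hd he]]|[a [[h [h0 hd <-]] ea]]].
  by exists (h k); split=> //; exists h; rewrite compm1.
by exists h; rewrite compm1 in h0.
Qed.

Lemma ext_realizer k M (y : chain A k.+1 M) : exists t : extension k.+1 A M,
  ext_realizes t y /\ forall s, ext_realizes s y -> extension_morphism s t.
Proof.
have [t [e [et en ie rt univ]]] := universal_realizer y.
exists (Extension et en ie); split=> // s rs; apply/ext_morphismP.
exact: univ (ext_exact s) rs.
Qed.

Lemma ext_realized k M (s : extension k A M) : exists c, ext_realizes s c /\
  forall x, ext_realizes s x -> cmor (idm M) c x.
Proof.
have [c [rc univ]] :=
  exists_realized (ext_exact s) (@ext_ends _ _ _ _ s) (ext_endP s).
by exists c; split=> // x; apply: univ.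
Qed.

Lemma ext_morphism_realizes k M (s t : extension k A M) x :
  extension_morphism s t -> ext_realizes t x -> ext_realizes s x.
Proof.
move=> /ext_morphismP[a [m ea]] r; rewrite /ext_realizes /realizes -ea compmA.
by rewrite -[X in cos_mor X](comp1m (idm M)); apply: cos_mor_comp m r.
Qed.

(** Zigzags of chains become zigzags of extensions: two extensions realizing one chain both map to
    its universal realizer. [yoneda_ceqv] is the converse, using the initial realized chain. *)
Lemma ceqv_yoneda k M (x y : chain A k.+1 M) s t : ceqv x y ->
  ext_realizes s x -> ext_realizes t y -> yoneda_equiv s t.
Proof.
have span (z : chain A k.+1 M) u v : ext_realizes u z -> ext_realizes v z ->
    yoneda_equiv u v.
  have [w [_ univ]] := ext_realizer z => /univ mu /univ mv.
  by apply: (rst_trans _ _ _ w); [|apply: rst_sym]; apply: rst_step.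
move=> e; elim: e s t => {x y} [x y m|x|x y _ IH|x y z _ IH _ IH'] s t.
- move=> rs; apply: span; rewrite /ext_realizes -(comp1m (idm M)).
  exact: realizes_cmor rs m.
- exact: span.
- by move=> rs rt; apply: rst_sym; apply: IH.
move=> rs rt; have [u [ru _]] := ext_realizer y.
exact: (rst_trans _ _ _ u _ (IH _ _ rs ru) (IH' _ _ ru rt)).
Qed.

Lemma yoneda_ceqv k M (s t : extension k A M) x y : yoneda_equiv s t ->
  ext_realizes s x -> ext_realizes t y -> ceqv x y.
Proof.
have cospan u (z w : chain A k M) : ext_realizes u z -> ext_realizes u w ->
    ceqv z w.
  have [v [_ univ]] := ext_realized u => /univ mz /univ mw.
  by apply: (ceqv_trans (y := v)); [apply: ceqv_sym|]; apply: ceqv_mor.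
move=> e; elim: e x y => {s t} [s t m|s|s t _ IH|s t u _ IH _ IH'] x y.
- by move=> rs /(ext_morphism_realizes m); apply: cospan.
- exact: cospan.
- by move=> rs rt; apply: ceqv_sym; apply: IH.
move=> rs rt; have [z [rz _]] := ext_realized t.
exact: ceqv_trans (IH _ _ rs rz) (IH' _ _ rz rt).
Qed.

Lemma Ext_eq0P k M : (0 < k)%N -> Ext_eq0 k A M <-> ext_trivial A k M.
Proof.
case: k => // k _; rewrite ext_trivialP; split=> H.
  move=> x y; have [s [rs _]] := ext_realizer x; have [t [rt _]] := ext_realizer y.
  exact: yoneda_ceqv (H s t) rs rt.
move=> s t; have [x [rx _]] := ext_realized s; have [y [ry _]] := ext_realized t.
exact: ceqv_yoneda (H x y) rx ry.
Qed.

End ExtChain.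

(** * Relative coresolutions *)

Section Coresolutions.
Local Open Scope ring_scope.
Context {C : abelianCat}.
Implicit Types (A B E K M O : C) (P Q Y : set C).

Lemma closed_summandsP P A B M :
  closed_summands P -> biproduct A B M -> P M -> P A.
Proof. by move=> cP b PM; apply: cP; exists B, M; split=> //; apply/is_sumP. Qed.

Lemma closed_isom P A M (f : hom A M) : closed_summands P -> isom f -> P M -> P A.
Proof.
move=> cP [g [gf fg]]; apply: (closed_summandsP (B := zobj)) => //.
apply: (@Biproduct _ _ _ _ f 0 g 0); rewrite ?compm0 ?comp0m ?addr0 //.
by apply/esym/zeroP/zobjP.
Qed.

Lemma closed_zero P M O : closed_summands P -> P M -> is_zero O -> P O.
Proof.
move=> cP PM zO; apply: closed_summandsP cP _ PM.
exact: biproduct_sym (biproduct_zero M zO).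
Qed.

Lemma closed_image P A B (f : hom A B) K (j : hom K B) :
  closed_summands P -> is_image f j -> image_in P f -> P K.
Proof.
move=> cP fj [I [i [fi PI]]].
by have [u iu] := image_uniq fi fj; apply: closed_isom iu PI.
Qed.

(** A member of a class closed under summands has every zero object as a summand, so the zero
    objects adjoined in infinite coresolutions add nothing. *)
Lemma closed_union P M : closed_summands P -> P M -> P `|` zero_objects = P.
Proof.
move=> cP PM; apply/seteqP; split=> x; last by left.
by case=> // zx; apply: closed_zero PM zx.
Qed.

Lemma vee_inf_coind P Q Y : Y `<=` P ->
  (forall M, Y M -> exists E K (i : hom M E) (p : hom E K),
    [/\ ses i p, Q E & Y K]) ->
  Y `<=` vee_inf P Q.
Proof.
move=> YP H M0 Y0; split; first exact: YP.
have {}H (m : {M | Y M}) : exists s : step (sval m),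
    Q (step_mid s) /\ Y (step_end s).
  have [E [K [i [p [s QE YK]]]]] := H _ (svalP m).
  by exists (Step s).
pose st m := sval (cid (H m)).
have stQ m : Q (step_mid (st m)) := proj1 (svalP (cid (H m))).
have stY m : Y (step_end (st m)) := proj2 (svalP (cid (H m))).
pose next m : {M | Y M} := exist _ _ (stY m).
(* Iterating the chosen successor gives the cosyzygies. Each differential is an epi followed by a
   mono, so exactness reduces to the kernels [kn]. *)
pose m n := iter n next (exist _ M0 Y0).
pose s := @Cosequence C M0 (fun n => step_mid (st (m n))) (step_in (st (m 0%N)))
  (fun n => step_in (st (m n.+1)) \oc step_out (st (m n))).
have mi n : is_mono (step_in (st (m n))) := ses_mono (stepP _).
have ep n : is_epi (step_out (st (m n))) := ses_epi (stepP _).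
have kn n : is_kernel (step_in (st (m n.+1)) \oc step_out (st (m n)))
    (step_in (st (m n))).
  exact: mono_comp_kernel (mi n.+1) (ses_ker (stepP _)).
exists s; split; last 1 first.
- move=> n; exists (step_end (st (m n))), (step_in (st (m n.+1))).
  split; first exact: epi_mono_image (ep n) (mi n.+1).
  by left; apply: YP.
- split; first exact: (mi 0%N).
    by apply/(mono_exact _ (mi 0%N)); apply: kn.
  by move=> n; apply/(epi_mono_exact _ (ep n) (mi n.+1)); apply: kn.
by move=> n; left; apply: stQ.
Qed.

Lemma vee_inf_uncons P Q M : closed_summands P -> zero_objects `<=` Q ->
  vee_inf P Q M -> exists E K (i : hom M E) (p : hom E K),
    [/\ ses i p, Q E & vee_inf P Q K].
Proof.
move=> cP Q0 [PM [s [es sQ sP]]].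
have [K [p [j [sp ej mj es']]]] := exact_uncons es.
have PK : P K.
  rewrite -(closed_union cP PM); apply: closed_image (sP 0%N).
    by rewrite (closed_union cP PM).
  by rewrite -ej; apply: epi_mono_image mj; apply: ses_epi sp.
exists (cterm s 0), K, (caug s), p; split=> //; first by case: (sQ 0%N) => // /Q0.
split=> //; exists (cos_shift j); split=> // k.
  exact: (sQ k.+1).
exact: (sP k.+1).
Qed.

(** Coinduction on the objects admitting one such step; [vee_inf_uncons] shows that the cokernel is
    again of this kind. *)
Lemma vee_inf_cons P Q M E K (i : hom M E) (p : hom E K) :
  closed_summands P -> zero_objects `<=` Q ->
  P M -> ses i p -> Q E -> vee_inf P Q K -> vee_inf P Q M.
Proof.
move=> cP Q0 PM s QE XK.
pose Y := [set N : C | P N /\ exists E K (i : hom N E) (p : hom E K),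
  [/\ ses i p, Q E & vee_inf P Q K]].
suff H : Y `<=` vee_inf P Q by apply: H; split=> //; exists E, K, i, p.
apply: vee_inf_coind => [N []//|N [_ [E' [K' [i' [p' [s' QE' XK']]]]]]].
exists E', K', i', p'; split=> //; split; first by case: XK'.
exact: vee_inf_uncons.
Qed.

(** Recursive form of coresolutions of length [n], in which every cosyzygy, [M] included, is
    required to lie in [P]. *)
Fixpoint cores P Q n M : Prop :=
  if n is n'.+1 then P M /\ exists E K (i : hom M E) (p : hom E K),
    [/\ ses i p, Q E & cores P Q n' K]
  else P M /\ Q M.

Lemma cores_mem P Q n M : cores P Q n M -> P M.
Proof. by case: n => [|n] []. Qed.

Lemma coresP P Q n M : closed_summands P -> closed_summands Q -> P M ->
  has_coresolution_of_length P Q n M <-> cores P Q n M.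
Proof.
move=> cP cQ; elim: n M => [|n IH] M PM; split.
- move=> [s [es en [_ Q0] _ _]]; split=> //.
  exact: closed_isom cQ (exact_single_isom es en) Q0.
- move=> [_ QM]; exists (cos_single M); split=> //; first exact: exact_single.
  exact: ends_single.
- move=> [s [es en PQ sQ sP]]; split=> //.
  have [K [p [j [sp ej mj es']]]] := exact_uncons es.
  have en' : ends_at n (cos_shift j) by move=> i; apply: (en i.+1).
  have PK : P K.
    (* In length one the cokernel is isomorphic to the last term, which lies in [P] by assumption;
       otherwise it is the image of the first differential. *)
    case: n {IH} en en' PQ sQ sP => [|n] en en' PQ sQ sP.
      by apply: closed_isom (exact_single_isom es' en') _ => //; case: PQ.
    apply: closed_image (sP 0%N isT) => //.
    by rewrite -ej; apply: epi_mono_image mj; apply: ses_epi sp.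
  exists (cterm s 0), K, (caug s), p; split=> //; first exact: sQ.
  apply/IH => //; exists (cos_shift j); split=> // i ?.
    exact: (sQ i.+1).
  exact: (sP i.+1).
move=> [_ [E [K [i [p [sp QE cK]]]]]]; have PK := cores_mem cK.
have [t [et en PQ tQ tP]] := (IH K PK).2 cK.
exists (cos_cons i p t); split=> //.
- exact: exact_cons.
- exact: ends_cons.
- by case=> // k; apply: tQ.
case=> [_|k]; last exact: tP.
exists K, (caug t); split=> //; apply: epi_mono_image (ses_epi sp) _.
by case: et.
Qed.

Lemma veeP P Q M : closed_summands P -> closed_summands Q ->
  vee P Q M <-> exists n, cores P Q n M.
Proof.
move=> cP cQ; split=> [[PM [n cM]]|[n cM]].
  by exists n; apply/coresP.
by have PM := cores_mem cM; split=> //; exists n; apply/coresP.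
Qed.

(** Each object is a coproduct of a family of length one. *)
Lemma add_class_summands P : add_class P = P -> closed_summands P.
Proof.
move=> aP A [B [M [s PM]]]; rewrite -aP; exists B, M; split=> //.
exists 1%N, (fun=> M); split=> //; exists (fun=> idm M) => T f.
exists (f ord0); split=> [i|v /(_ ord0) <-]; last by rewrite compm1.
by rewrite compm1 (ord1 i).
Qed.

Lemma add_class_zero P : add_class P = P -> zero_objects `<=` P.
Proof.
move=> aP O zO; rewrite -aP; exists O, O; split.
  by apply/is_sumP; split; apply: biproduct_zero.
exists 0%N, (fun=> O); split; first by case.
exists (fun=> idm O) => T f; exists 0; split; first by case.
by move=> v _; rewrite (zero_from v zO).
Qed.

Lemma add_class_biproduct P A B S :
  add_class P = P -> biproduct A B S -> P A -> P B -> P S.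
Proof.
move=> aP b PA PB; rewrite -aP; exists zobj, S; split.
  by apply/is_sumP; split; apply: biproduct_zero zobjP.
pose F (i : 'I_2) : C := if val i is 0%N then A else B.
exists 2%N, F; split; first by move=> [[|i] ?].
exists (fun i : 'I_2 =>
  match val i as n return hom (if n is 0%N then A else B) S with
  | 0%N => in1 b | _ => in2 b end) => T f.
exists (copairm b (f ord0) (f (Ordinal (isT : (1 < 2)%N)))); split.
  case=> [[|[|i]] h] //=.
    by rewrite copair_in1 (bool_irrelevance h (ltn0Sn 1)).
  by rewrite copair_in2 (bool_irrelevance h isT).
move=> v Hv; apply: (copair_uniq (b := b)).
  by rewrite copair_in1 -Hv.
by rewrite copair_in2 -Hv.
Qed.

End Coresolutions.

Lemma enat_min_some (P : set nat) n : enat_min P = Some n -> P n.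
Proof.
rewrite /enat_min; case: pselect => // h [<-].
by case: ex_minnP => m /asboolP.
Qed.

Lemma enat_min_finite (P : set nat) :
  enat_min P <> enat_infty <-> exists n, P n.
Proof.
rewrite /enat_min; case: pselect => [h|h]; split=> //.
  by move=> _; case: h => n /asboolP Pn; exists n.
by case=> n Pn; case: h; exists n; apply/asboolP.
Qed.

(** * Closure properties and relative injective dimension *)

Section Vee.
Context {C : abelianCat} {Z nu : set C}.
Hypothesis Z_smd : closed_summands Z.
Hypothesis Z_ext : closed_extensions Z.
Hypothesis nu_add : add_class nu = nu.
Hypothesis nu_inj : forall A N k, Z A -> nu N -> (0 < k)%N -> ext_trivial A k N.
Implicit Types A B D E K M N : C.

Let nu_smd : closed_summands nu := add_class_summands nu_add.
Let nu_zero : zero_objects `<=` nu := add_class_zero nu_add.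
Let X := vee_inf Z nu.

Let Z_ses M E K (i : hom M E) (p : hom E K) : ses i p -> Z M -> Z K -> Z E.
Proof. by move=> /short_exactP; apply: Z_ext. Qed.

(** Coinduction on the extensions of objects of [X]: Ext^1([D], [Qa]) = 0 extends [i] to [B], and
    the horseshoe produces a cokernel that is again such an extension. *)
Lemma vee_inf_ses A B D (a : hom A B) (d : hom B D) :
  ses a d -> X A -> X D -> X B.
Proof.
move=> s XA XD; pose Y := [set N : C | exists A D (a : hom A N) (d : hom N D),
  [/\ ses a d, X A & X D]].
suff H : Y `<=` X by apply: H; exists A, D, a, d.
apply: vee_inf_coind => {A B D a d s XA XD} B [A [D [a [d [s XA XD]]]]].
  by apply: Z_ses s _ _; [case: XA|case: XD].
have [Qa [Ka [i [p [sa nQa XKa]]]]] := vee_inf_uncons Z_smd nu_zero XA.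
have [Qd [Kd [i' [p' [sd nQd XKd]]]]] := vee_inf_uncons Z_smd nu_zero XD.
have [|r ri] := ext1_extend i _ s; first by apply: nu_inj => //; case: XD.
have [K [m [q [x [y [sq sxy]]]]]] := horseshoe (bsumb Qa Qd) s sa sd ri.
exists (bsum Qa Qd), K, m, q; split=> //; last by exists Ka, Kd, x, y.
exact: add_class_biproduct nu_add (bsumb Qa Qd) nQa nQd.
Qed.

(** Coinduction on the summands of objects of [X]: by [ses_complement] the cokernel is a summand of
    an extension of [B'] by [B], which lies in [X]. *)
Lemma vee_inf_summand M N B : biproduct M N B -> X B -> X M.
Proof.
move=> b XB; pose Y := [set M : C | exists N B, inhabited (biproduct M N B) /\ X B].
suff H : Y `<=` X by apply: H; exists N, B.
apply: vee_inf_coind => {M N B b XB} M [N [B [[b] XB]]].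
  by apply: closed_summandsP b _ => //; case: XB.
have [Q [B' [i [p [s nQ XB']]]]] := vee_inf_uncons Z_smd nu_zero XB.
have [|M1 [q sq]] := @mono_ses _ _ _ (i \oc in1 b).
  exact: mono_comp (ses_mono s) (ses_mono (ses_biproduct b)).
exists Q, M1, (i \oc in1 b), q; split=> //.
have [n [r [j [t [_ st]]]]] := ses_complement (bsumb M1 M) s sq.
exists M, (bsum M1 M); split; first by split; apply: bsumb.
exact: vee_inf_ses st XB XB'.
Qed.

(** Embed [A] through [B] into [Q]; the cokernel is an extension of [B'] by [D]. *)
Lemma vee_inf_epi_kernel A B D (a : hom A B) (d : hom B D) :
  ses a d -> Z A -> X B -> X D -> X A.
Proof.
move=> s ZA XB XD.
have [Q [B' [i [p [si nQ XB']]]]] := vee_inf_uncons Z_smd nu_zero XB.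
have [|A1 [q sq]] := @mono_ses _ _ _ (i \oc a).
  exact: mono_comp (ses_mono si) (ses_mono s).
have [c [r [sc _ _]]] := third_iso s si sq.
apply: vee_inf_cons sq nQ _ => //.
exact: vee_inf_ses sc XD XB'.
Qed.

Lemma cores_vee_inf n M : cores Z nu n M -> X M.
Proof.
elim: n M => [|n IH] M.
  move=> [ZM nM].
  apply: (vee_inf_cons (Q := nu) Z_smd nu_zero ZM (ses_id M zobjP) nM).
  (* After [M -> M -> 0] the coresolution continues with zero objects. *)
  apply: (vee_inf_coind (Y := zero_objects)) zobjP => O zO.
    exact: closed_zero Z_smd ZM zO.
  by exists O, O, (idm O), 0%R; split=> //; [exact: ses_id|exact: nu_zero].
move=> [ZM [E [K [i [p [s nE /IH XK]]]]]].
exact: vee_inf_cons s nE XK.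
Qed.

Lemma cores_ext n M : cores Z nu n M ->
  forall A k, Z A -> (n < k)%N -> ext_trivial A k M.
Proof.
elim: n M => [|n IH] M; first by move=> [_ nM] A k ZA; apply: nu_inj.
move=> [_ [E [K [i [p [s nE /IH tK]]]]]] A [|k] // ZA nk.
by apply: (ext_trivial_left s); [apply: tK|apply: nu_inj].
Qed.

Lemma ext_cores n M : X M ->
  (forall A k, X A -> (n < k)%N -> ext_trivial A k M) -> cores Z nu n M.
Proof.
elim: n M => [|n IH] M XM tM; have ZM : Z M by case: XM.
  have [E [K [i [p [s nE XK]]]]] := vee_inf_uncons Z_smd nu_zero XM.
  (* The cokernel [K] is itself in [X], so the sequence splits and [M] is a summand of [E]. *)
  have [r ri] := ext1_split (tM K 1%N XK isT) s.
  by split=> //; have [b] := split_biproduct s ri; apply: closed_summandsP b nE.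
have [E [K [i [p [s nE XK]]]]] := vee_inf_uncons Z_smd nu_zero XM.
split=> //; exists E, K, i, p; split=> //; apply: IH => // A k XA nk.
apply: (ext_trivial_right s); last exact: tM.
by apply: nu_inj => //; [case: XA|apply: leq_ltn_trans nk].
Qed.

Lemma cores_extP n M : X M -> cores Z nu n M <->
  (forall A k, X A -> (n < k)%N -> ext_trivial A k M).
Proof.
move=> XM; split=> [c A k [ZA _]|]; last exact: ext_cores.
exact: cores_ext.
Qed.

Lemma vee_extP M : vee Z nu M <->
  X M /\ exists n, forall A k, X A -> (n < k)%N -> ext_trivial A k M.
Proof.
rewrite veeP //; split=> [[n c]|[XM [n t]]].
  have XM := cores_vee_inf c.
  by split=> //; exists n; apply/cores_extP.
by exists n; apply/cores_extP.
Qed.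

Lemma vee_ses A B D (a : hom A B) (d : hom B D) :
  ses a d -> vee Z nu A -> vee Z nu D -> vee Z nu B.
Proof.
move=> s /vee_extP[XA [m tA]] /vee_extP[XD [n tD]]; apply/vee_extP; split.
  exact: vee_inf_ses s XA XD.
exists (maxn m n) => F k XF; rewrite gtn_max => /andP[mk nk].
by apply: (ext_trivial_mid s); [apply: tA|apply: tD].
Qed.

Lemma vee_summand M N B : biproduct M N B -> vee Z nu B -> vee Z nu M.
Proof.
move=> b /vee_extP[XB [n tB]]; apply/vee_extP; split.
  exact: vee_inf_summand b XB.
by exists n => F k XF nk; apply: ext_trivial_split b _; apply: tB.
Qed.

Lemma vee_epi_kernel A B D (a : hom A B) (d : hom B D) :
  ses a d -> Z A -> vee Z nu B -> vee Z nu D -> vee Z nu A.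
Proof.
move=> s ZA /vee_extP[XB [m tB]] /vee_extP[XD [n tD]]; apply/vee_extP; split.
  exact: vee_inf_epi_kernel s ZA XB XD.
(* The bound grows by one because the connecting map takes Ext^k into [D] to Ext^(k+1) into [A]. *)
exists (maxn m n).+1 => F [|k] XF //; rewrite ltnS gtn_max => /andP[mk nk].
by apply: (ext_trivial_left s); [apply: tD|apply: tB => //; apply: ltnW].
Qed.

Lemma idim_bound n M :
  (forall A, X A -> forall k, (n < k)%N -> Ext_eq0 k A M) <->
  (forall A k, X A -> (n < k)%N -> ext_trivial A k M).
Proof.
by split=> H A; [move=> k XA nk|move=> XA k nk];
  apply/Ext_eq0P; rewrite ?(leq_ltn_trans _ nk) //; apply: H.
Qed.

Lemma vee_idim M : vee Z nu M <-> X M /\ idim X M <> enat_infty.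
Proof.
rewrite vee_extP enat_min_finite; split=> -[XM [n t]]; split=> //; exists n.
  exact/idim_bound.
exact/idim_bound.
Qed.

(** Both sides are minima of the same set, by [cores_extP]. *)
Lemma idim_coresdim M : vee Z nu M -> idim X M = coresdim Z nu M.
Proof.
move=> /vee_extP[XM _]; congr enat_min; apply/seteqP.
have ZM : Z M by case: XM.
by split=> n /=; rewrite idim_bound coresP // cores_extP.
Qed.

(** Each term of the coresolution is an extension of two consecutive cosyzygies, both in [Z]. *)
Lemma vee_inf_cap : X = vee_inf Z (Z `&` nu).
Proof.
apply/seteqP; split=> [M XM|M XM].
  apply: (vee_inf_coind (Y := X)) XM => [N []//|N XN].
  have [E [K [i [p [s nE XK]]]]] := vee_inf_uncons Z_smd nu_zero XN.
  exists E, K, i, p; split=> //; split=> //.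
  by apply: Z_ses s _ _; [case: XN|case: XK].
have ZM : Z M by case: XM.
apply: (vee_inf_coind (Y := vee_inf Z (Z `&` nu))) XM => [N []//|N XN].
have [|E [K [i [p [s [_ nE] XK]]]]] := vee_inf_uncons Z_smd _ XN.
  by move=> O zO; split; [exact: closed_zero Z_smd ZM zO|exact: nu_zero].
by exists E, K, i, p.
Qed.

Lemma cores_cap n M : cores Z nu n M <-> cores Z (Z `&` nu) n M.
Proof.
elim: n M => [|n IH] M /=; first by split=> [[]|[? []]].
split=> -[ZM [E [K [i [p [s nE cK]]]]]]; split=> //; exists E, K, i, p.
  split=> //; last exact/IH.
  by split=> //; apply: Z_ses s ZM (cores_mem cK).
by split=> //; [case: nE|apply/IH].
Qed.

Lemma vee_cap : vee Z nu = vee Z (Z `&` nu).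
Proof.
have cap_smd : closed_summands (Z `&` nu).
  by move=> A [B [M [s [ZM nM]]]]; split; [apply: Z_smd|apply: nu_smd]; exists B, M.
apply/seteqP; split=> M; rewrite !veeP //; case=> n c; exists n; exact/cores_cap.
Qed.

End Vee.

Lemma relatively_injectiveP (C : abelianCat) (Z nu : set C) :
  relatively_injective Z nu ->
  forall A N k, Z A -> nu N -> (0 < k)%N -> ext_trivial A k N.
Proof.
move=> /enat_min_some H A N k ZA nN k0; apply/Ext_eq0P => //.
have : enat_le (idim Z N) (Some 0%N) by apply: H; exists N.
(* The bound by 0 excludes infinity and positive values, and a minimum equal to 0 is attained. *)
case e : (idim Z N) => [[|m]|] // _.
by have := enat_min_some e; apply.
Qed.

Theorem theorem4p20 (C : abelianCat) (Z nu : set C)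
    (Z_smd : Z = smd Z) (Z_ext : closed_extensions Z)
    (nu_add : add_class nu = nu) (nu_inj : relatively_injective Z nu) :
  (* (a) *)
  ([/\ closed_extensions (vee_inf Z nu), closed_summands (vee_inf Z nu),
       closed_extensions (vee Z nu) & closed_summands (vee Z nu)]
   /\ vee_inf Z nu = vee_inf Z (Z `&` nu)
   /\ vee Z nu = vee Z (Z `&` nu)
   /\ vee Z (Z `&` nu)
      = [set M | vee_inf Z nu M /\ idim (vee_inf Z nu) M <> enat_infty])
  (* (b) *)
  /\ (forall M : C, vee Z nu M -> idim (vee_inf Z nu) M = coresdim Z nu M)
  (* (c) *)
  /\ (left_thick Z -> left_thick (vee_inf Z nu) /\ left_thick (vee Z nu)).
Proof.
have Zs : closed_summands Z by rewrite /closed_summands -Z_smd.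
have inj := relatively_injectiveP nu_inj.
have Xe : closed_extensions (vee_inf Z nu).
  by move=> A B D a d /short_exactP s; apply: vee_inf_ses s.
have Xs : closed_summands (vee_inf Z nu).
  by move=> A [B [M [/is_sumP[b] XM]]]; apply: vee_inf_summand b XM.
have We : closed_extensions (vee Z nu).
  by move=> A B D a d /short_exactP s; apply: vee_ses s.
have Ws : closed_summands (vee Z nu).
  by move=> A [B [M [/is_sumP[b] XM]]]; apply: vee_summand b XM.
split; [split=> //; split; last split|split].
- exact: vee_inf_cap.
- exact: vee_cap.
- rewrite -vee_cap //; apply/seteqP; split=> M /=; by rewrite vee_idim.
- by move=> M; apply: idim_coresdim.
(* Left thickness of [Z] puts the kernel in [Z], as the epi-kernel lemmas require. *)
move=> [_ _ Zk]; split; split=> // A B D a d sad XB XD;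
  have ZA : Z A by (apply: Zk sad _ _; [case: XB|case: XD]).
- by move/short_exactP: sad => s; apply: (vee_inf_epi_kernel _ _ _ _ s).
by move/short_exactP: sad => s; apply: (vee_epi_kernel _ _ _ _ s).
Qed.
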